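(* Let $m\ge 1$ be an integer and let $\mathcal{A}_{3m}$ be the minimal regular cover of the $3m$-antiprism. Then $\mathcal{A}_{3m}$ has $6m^4$ vertices, $12m^4$ edges and $8m^3$ faces, and it lies on a compact orientable surface of Euler characteristic $8m^3-12m^4+6m^4$, that is, of genus $3m^4-4m^3+1$.
   Context: An abstract polyhedron $\mathcal{P}$ is a partially ordered set such that: (P1) it has a unique minimum face $F_{-1}$ and a unique maximum face $F_3$; (P2) every maximal totally ordered subset (flag) contains $F_{-1}$ and $F_3$ and has exactly $5$ elements (so there is a rank function; the elements of rank $0,1,2$ are vertices, edges, faces); (P3) it is strongly connected, meaning every section $G/F=\{H: F\le H\le G\}$ is connected, where a poset of rank $n$ is connected if $n\le 1$ or any two of its proper faces are joined by a finite sequence of proper faces with consecutive ones incident (comparable); (P4) every edge is incident to exactly two vertices and exactly two faces, and if a vertex $V$ is incident to a face $F$ there are exactly two edges incident to both. For a flag $\Psi$ and $i\in\{0,1,2\}$, $\Psi^i$ denotes the unique flag differing from $\Psi$ exactly in its element of rank $i$. $\Gamma(\mathcal{P})$ is the automorphism group of $\mathcal{P}$; $\mathcal{P}$ is regular if $\Gamma(\mathcal{P})$ is transitive on flags. For a regular $\mathcal{P}$ with base flag $\Phi$, the distinguished generators are the involutions $\rho_i$ with $\Phi\rho_i=\Phi^i$. The monodromy group $\mathrm{Mon}(\mathcal{Q})=\langle r_0,r_1,r_2\rangle$ of a polyhedron $\mathcal Q$ is the group of permutations of its flags generated by $r_i:\Psi\mapsto\Psi^i$. A regular polyhedron $\mathcal{P}$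 covers $\mathcal{Q}$ if there is a group homomorphism $\Gamma(\mathcal{P})\to\mathrm{Mon}(\mathcal{Q})$ with $\rho_i\mapsto r_i$ for $i=0,1,2$. $\mathcal{P}$ is a minimal regular cover of $\mathcal{Q}$ if $\mathcal{P}$ is regular, covers $\mathcal{Q}$, and any regular polyhedron $\mathcal{R}$ that covers $\mathcal{Q}$ and is covered by $\mathcal{P}$ equals $\mathcal{P}$. (It is known that the minimal regular cover is unique up to isomorphism: it is the regular polyhedron whose automorphism group with distinguished generators is $\mathrm{Mon}(\mathcal{Q})$ with generators $r_0,r_1,r_2$.) The $n$-antiprism is the face lattice of the convex $n$-gonal antiprism: vertices $u_i,v_i$ ($i\in\mathbb{Z}/n$), edges $u_iu_{i+1}$, $v_iv_{i+1}$, $u_iv_i$, $u_iv_{i+1}$, and faces the two $n$-gons $u_0\cdots u_{n-1}$, $v_0\cdots v_{n-1}$ and the $2n$ triangles $u_iu_{i+1}v_{i+1}$ and $v_iv_{i+1}u_i$ (the $3$-antiprism is the octahedron). The surface on which a finite polyhedron lies is the surface obtained by taking one triangle for each flag, with corners labelled $0,1,2$, and gluing the triangles of $\Psi$ and $\Psi^i$ along the sides opposite the corners labelled $i$ (respecting labels); the polyhedron is thereby a map on this surface, with Euler characteristic the number of vertices minus the number of edges plus the number of faces. *)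

(* Defs.v *)
From HB Require Import structures.
From Stdlib Require Import Relation_Operators.
From mathcomp Require Import all_boot all_order all_algebra generic_quotient finmap.
From mathcomp Require Import all_classical all_reals all_analysis.

Set Implicit Arguments.
Unset Strict Implicit.
Unset Printing Implicit Defensive.

Import Order.TTheory GRing.Theory Num.Theory.
Import numFieldNormedType.Exports.

Local Open Scope order_scope.
Local Open Scope card_scope.
Local Open Scope classical_set_scope.

(* The group of all permutations of a possibly infinite type. As for          *)
(* {perm T}, permutations act on the right: (s * t) x = t (s x).              *)
Section Sym.
Context {T : choiceType}.

Record sym := Sym { sym_fun :> T -> T; symP : `[< bijective sym_fun >] }.

HB.instance Definition _ := [isSub of sym for sym_fun].
HB.instance Definition _ := [Choice of sym by <:].

Lemma sym1_subproof : `[< bijective (@id T) >].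
Proof. by apply/asboolP; exists id. Qed.
Definition sym1 := Sym sym1_subproof.

Lemma symM_subproof (s t : sym) : `[< bijective (t \o s) >].
Proof.
by apply/asboolP/bij_comp; apply/asboolP/symP.
Qed.
Definition symM (s t : sym) := Sym (symM_subproof s t).

Lemma symV_ex (s : sym) : {t : sym | cancel s t & cancel t s}.
Proof.
apply: cid2; have /asboolP[g fK gK] := symP s.
have gP : `[< bijective g >] by apply/asboolP; exists s.
by exists (Sym gP).
Qed.
Definition symV (s : sym) := s2val (symV_ex s).

Lemma symMA : associative symM. Proof. by move=> s t u; apply/val_inj. Qed.
Lemma sym1M : left_id sym1 symM. Proof. by move=> s; apply/val_inj. Qed.
Lemma symM1 : right_id sym1 symM. Proof. by move=> s; apply/val_inj. Qed.
Lemma symVM : left_inverse sym1 symV symM.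
Proof.
by move=> s; apply/val_inj/funext => x /=; rewrite /symV; case: symV_ex.
Qed.
Lemma symMV : right_inverse sym1 symV symM.
Proof.
by move=> s; apply/val_inj/funext => x /=; rewrite /symV; case: symV_ex.
Qed.

HB.instance Definition _ := isGroup.Build sym symMA sym1M symM1 symVM symMV.

End Sym.
Arguments sym : clear implicits.

Definition is_subgroup {G : groupType} (H : set G) : Prop :=
  H 1%g /\ forall x y, H x -> H y -> H (x / y)%g.

Definition generated {G : groupType} (S : set G) : set G :=
  smallest is_subgroup S.

Section Polyhedra.
Context {d : Order.disp_t} (P : tbPOrderType d).
Implicit Types (x y F G : P) (C : set P).

Definition is_chain C : Prop := forall x y, C x -> C y -> x >=< y.

Definition is_flag C : Prop :=
  is_chain C /\ forall C', is_chain C' -> C `<=` C' -> C' = C.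

Definition flag := set_type [set C | is_flag C].

(* In a flag of a polyhedron, an element of rank i has exactly i + 1 elements *)
(* below it, of ranks -1, 0, ..., i - 1.                                      *)
Definition of_rank (i : nat) : set P :=
  [set x | exists C, [/\ is_flag C, C x & [set y | C y /\ y < x] #= `I_i.+1]].

Definition proper_faces F G : set P := [set H | F < H < G].

(* The flags of a section G / F of rank n have exactly n proper faces; the    *)
(* section F / F, of rank -1, has none.                                       *)
Definition section_rank_le1 F G : Prop :=
  exists C, [/\ is_flag C, C F, C G & C `&` proper_faces F G #<= `I_1].

Definition section_connected F G : Prop :=
  section_rank_le1 F G \/
  forall H K, proper_faces F G H -> proper_faces F G K ->
    exists s : seq P, [/\ {in s, forall L, proper_faces F G L},
                          path (fun x y => x >=< y) H s & last H s = K].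

(* The existence of a least and a greatest face is part of the structure of   *)
(* P: they are \bot and \top.                                                 *)
Definition polyhedron : Prop :=
  [/\ forall C, is_flag C -> [/\ C \bot, C \top & C #= `I_5],
      forall F G, F <= G -> section_connected F G,
      forall E, of_rank 1 E ->
        [set V | of_rank 0 V /\ V >=< E] #= `I_2 /\
        [set F | of_rank 2 F /\ F >=< E] #= `I_2
    & forall V F, of_rank 0 V -> of_rank 2 F -> V >=< F ->
        [set E | [/\ of_rank 1 E, E >=< V & E >=< F]] #= `I_2].

(* i_adjacent i Phi Psi means that Psi is the flag Phi^i.                     *)
Definition i_adjacent (i : 'I_3) (Phi Psi : flag) : Prop :=
  Phi <> Psi /\ val Phi `\` of_rank i = val Psi `\` of_rank i.

Definition automorphisms : set (sym P) :=
  [set s : sym P | {mono s : x y / x <= y}].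

Definition regular : Prop :=
  forall Phi Psi : flag, exists2 s, automorphisms s & s @` val Phi = val Psi.

Definition is_distinguished_generator (Phi : flag) (i : 'I_3) (s : sym P) :=
  automorphisms s /\
  exists2 Psi, i_adjacent i Phi Psi & s @` val Phi = val Psi.

(* The identity is a dummy value, used only when P is not a polyhedron.       *)
Definition mon_generator (i : 'I_3) : sym flag :=
  xget 1%g [set r : sym flag | forall Psi, i_adjacent i Psi (r Psi)].

Definition monodromy_group : set (sym flag) := generated (range mon_generator).

Definition euler_characteristic : int :=
  ((#|` fset_set (of_rank 0)|)%:Z - (#|` fset_set (of_rank 1)|)%:Z
   + (#|` fset_set (of_rank 2)|)%:Z)%R.

(* One of the two cyclic orders of the corners 0, 1, 2 of a triangle.         *)
Definition next_corner (b : bool) (j : 'I_3) : 'I_3 :=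
  if b then ordS j else ord_pred j.

(* Orientability of a triangulated surface: the triangles can be oriented so  *)
(* that any two triangles glued along a side, here the side joining the       *)
(* corners j and k other than i, induce opposite directions on that side.     *)
Definition orientable : Prop :=
  exists o : flag -> bool, forall i Phi Psi, i_adjacent i Phi Psi ->
    forall j k, j != i -> k != i ->
      next_corner (o Phi) j = k -> next_corner (o Psi) k = j.

End Polyhedra.

Definition isomorphic {d d' : Order.disp_t}
    (P : tbPOrderType d) (Q : tbPOrderType d') : Prop :=
  exists2 f : P -> Q, bijective f & {mono f : x y / x <= y}.

(* P covers Q, for a regular polyhedron P: a homomorphism from Gamma(P) to    *)
(* Mon(Q) is a function on all permutations, of which only the values on      *)
(* Gamma(P) are relevant.                                                     *)
Definition covers {d d' : Order.disp_t}
    (P : tbPOrderType d) (Q : tbPOrderType d') : Prop :=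
  exists (Phi : flag P) (rho : 'I_3 -> sym P) (h : sym P -> sym (flag Q)),
    [/\ forall i, is_distinguished_generator Phi i (rho i),
        forall s, automorphisms s -> monodromy_group (h s),
        forall s t, automorphisms s -> automorphisms t ->
          h (s * t)%g = (h s * h t)%g
      & forall i, h (rho i) = mon_generator Q i].

Definition minimal_regular_cover {d d' : Order.disp_t}
    (P : tbPOrderType d) (Q : tbPOrderType d') : Prop :=
  [/\ polyhedron P, regular P, covers P Q
    & forall (e : Order.disp_t) (R : tbPOrderType e),
        polyhedron R -> regular R -> covers R Q -> covers P R ->
        isomorphic R P].

(* The surface of P: a disjoint union of triangles indexed by the flags, with *)
(* points given in barycentric coordinates, where the side opposite the       *)
(* corner i of Phi (on which the i-th coordinate vanishes) is glued to the    *)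
(* corresponding side of Phi^i.                                               *)
Section Surface.
Context (R : realType) {d : Order.disp_t} (P : tbPOrderType d).

Definition triangle : set 'rV[R]_3 :=
  [set x : 'rV[R]_3 | (forall i, 0 <= x 0 i)%R /\ (\sum_i x 0 i = 1)%R].

Definition triangles : topologicalType :=
  {_ : flag P & set_type triangle}.

Definition glued_side (p q : triangles) : Prop :=
  exists i : 'I_3, [/\ i_adjacent i (tag p) (tag q),
    val (tagged p) = val (tagged q) & (val (tagged p) 0 i = 0)%R].

Definition glued (p q : triangles) : bool :=
  `[< clos_refl_sym_trans triangles glued_side p q >].

Lemma glued_refl : reflexive glued.
Proof. by move=> p; apply/asboolP/rst_refl. Qed.

Lemma glued_sym : symmetric glued.
Proof. by move=> p q; apply: asbool_equiv_eq; split; exact: rst_sym. Qed.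

Lemma glued_trans : transitive glued.
Proof.
by move=> q p r /asboolP pq /asboolP qr; apply/asboolP/(rst_trans _ _ _ _ _ pq).
Qed.

Canonical glued_equiv := EquivRel glued glued_refl glued_sym glued_trans.

Definition surface : topologicalType :=
  quotient_topology {eq_quot glued}%qT.

(* A compact connected orientable surface of genus g has Euler characteristic *)
(* 2 - 2g.                                                                    *)
Definition has_genus (g : nat) : Prop :=
  [/\ compact [set: surface], connected [set: surface], orientable P
    & euler_characteristic P = (2 - 2 * g%:Z)%R].

End Surface.

(* The face lattice of the n-antiprism, 3 <= n: each face is represented by   *)
(* the set of its vertices, and the order is inclusion. Here u i and v i are  *)
(* inl i and inr i, and ordS is the cyclic successor on 'I_n.                 *)
Section Antiprism.
Import Order.DefaultSetSubsetOrder.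
Local Notation disp := Order.SetSubsetOrder.subset_display.
Local Open Scope set_scope.
Context (n : nat).

Local Notation antiprism_vertex := ('I_n + 'I_n)%type.

Let u (i : 'I_n) : antiprism_vertex := inl i.
Let v (i : 'I_n) : antiprism_vertex := inr i.

Definition antiprism_edges : {set {set antiprism_vertex}} :=
  [set [set u i; u (ordS i)] | i : 'I_n] :|:
  [set [set v i; v (ordS i)] | i : 'I_n] :|:
  [set [set u i; v i] | i : 'I_n] :|:
  [set [set u i; v (ordS i)] | i : 'I_n].

Definition antiprism_2faces : {set {set antiprism_vertex}} :=
  [set [set u i | i : 'I_n]; [set v i | i : 'I_n]] :|:
  [set [set u i; u (ordS i); v (ordS i)] | i : 'I_n] :|:
  [set [set v i; v (ordS i); u i] | i : 'I_n].

Definition antiprism_faces : {set {set antiprism_vertex}} :=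
  [set finset.set0; [set: antiprism_vertex]] :|:
  [set [set x] | x : antiprism_vertex] :|:
  antiprism_edges :|: antiprism_2faces.

Definition antiprism : Type :=
  {A : {set antiprism_vertex} | A \in antiprism_faces}.

HB.instance Definition _ := SubChoice.on antiprism.
HB.instance Definition _ :=
  [SubChoice_isSubPOrder of antiprism by <: with disp].

Lemma antiprism_set0 : finset.set0 \in antiprism_faces.
Proof. by rewrite !inE eqxx. Qed.

Lemma antiprism_setT : [set: antiprism_vertex] \in antiprism_faces.
Proof. by rewrite !inE eqxx orbT. Qed.

Definition antiprism_bottom : antiprism :=
  exist (fun A => A \in antiprism_faces) _ antiprism_set0.
Definition antiprism_top : antiprism :=
  exist (fun A => A \in antiprism_faces) _ antiprism_setT.

Lemma antiprism_le0x (x : antiprism) : antiprism_bottom <= x.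
Proof. exact: finset.sub0set. Qed.

Lemma antiprism_lex1 (x : antiprism) : x <= antiprism_top.
Proof. exact: finset.subsetT. Qed.

HB.instance Definition _ :=
  Order.hasBottom.Build disp antiprism antiprism_le0x.
HB.instance Definition _ :=
  Order.hasTop.Build disp antiprism antiprism_lex1.

End Antiprism.

(* Main.v *)
From HB Require Import structures.
From Stdlib Require Import Relation_Operators.
Require Import Defs.
From mathcomp Require Import all_boot all_order all_algebra all_fingroup cyclic generic_quotient.
From mathcomp Require Import all_classical all_reals all_analysis.
From mathcomp Require Import ring zify.

(** Put n = 3m. Read along the zigzag v_0, u_0, v_1, u_1, ..., the vertices of
    the n-antiprism form the cyclic group Z/6m: v_i is 2i, u_i is 2i + 1, two
    vertices are adjacent when they differ by 1 or 2, the triangles are the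
    sets {k, k + 1, k + 2}, and the two n-gons are the parity classes. The
    dihedral group of order 12m acts freely on the 48m flags, with four orbits,
    so that a flag is a triple of a vertex, a direction along the zigzag and one
    of four types. The permutations r_0, r_1, r_2 that generate the monodromy
    group M are then given by explicit formulas ([adj]).

    The order of M is 48 m^4 ([card_flag_group]). Indeed, reducing the vertices
    modulo 6 maps the flags onto those of the octahedron, compatibly with the
    r_i, and the monodromy group of the octahedron is simply transitive on its
    48 flags because the octahedron is regular ([owalk_adj]). An element of M
    that acts trivially modulo 6 moves each flag of a given type along its own
    direction by a multiple of 6 that depends on the type only, since M commutes
    with the dihedral group; there are at most m^4 such permutations. All of
    them occur ([kernelE]): (r_0 r_1)^3 moves the flags at the two n-gons by 6
    and fixes the flags at the triangles, where r_0 r_1 has order 3, and its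
    conjugates by r_1 and r_2 do the same for the three other types.

    The subgroups <r_1, r_2>, <r_0, r_2>, <r_0, r_1> are dihedral of orders 8, 4
    and 6m. They intersect as in a string C-group, so that the cosets of these
    subgroups, two of them being incident when they meet, are the faces of a
    regular polyhedron P with automorphism group M ([coset_polyhedron],
    [coset_regular]). The flags of P are the elements of M, on which the
    monodromy group of P acts by right multiplication; it is thus a copy of M.
    Hence P covers the antiprism ([coset_covers]), and every regular polyhedron
    that covers the antiprism also covers P ([cover_factor]), so a minimal
    regular cover A is isomorphic to P. The numbers of faces of A are therefore
    the indices of the three subgroups in M.

    The surface of A is compact since A has finitely many flags, connected since
    M is transitive on them, and orientable since each r_i exchanges the two
    classes of flags of the antiprism given by its orientation. The genus is
    read off from the Euler characteristic. *)

Set Implicit Arguments.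
Unset Strict Implicit.
Unset Printing Implicit Defensive.

Import Order.TTheory GRing.Theory Num.Theory.
Import numFieldNormedType.Exports.

Local Open Scope order_scope.
Local Open Scope card_scope.
Local Open Scope classical_set_scope.

(** * Preliminaries *)

Local Notation o0 := (@Ordinal 3 0 isT).
Local Notation o1 := (@Ordinal 3 1 isT).
Local Notation o2 := (@Ordinal 3 2 isT).

(** In a finite group, inverses are not needed to generate a subgroup. *)
Lemma gen_ind (gT : finGroupType) (A : {set gT}) (K : gT -> Prop) :
  K 1%g -> (forall x a, K x -> a \in A -> K (x * a)%g) ->
  forall x, x \in <<A>>%g -> K x.
Proof.
move=> K1 KM x /gen_prodgP[n [c cA ->]].
elim: n c cA => [|n IH] c cA; first by rewrite big_ord0.
by rewrite big_ord_recr; apply: KM => //=; apply: IH.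
Qed.

Lemma card_set2 (T : Type) (a b : T) : a <> b -> [set a; b] #= `I_2.
Proof.
move=> ab; apply/eq_cardSP; exists a; first by left.
rewrite [X in X #= _](_ : _ = [set b]) ?card_set1//.
rewrite eqEsubset; split=> [x [[->|->//]]|_ ->]; first by case.
by split; [right|move=> /esym].
Qed.

Lemma ord3_case (K : 'I_3 -> Prop) :
  K o0 -> K o1 -> K o2 -> forall i, K i.
Proof.
by move=> K0 K1 K2 [[|[|[|//]]] i3]; [move: K0|move: K1|move: K2];
  congr (K _); apply: val_inj.
Qed.

Lemma card_finpred (T : finType) (D : {pred T}) : [set x | x \in D] #= `I_#|D|.
Proof.
have -> : [set x | x \in D] = enum_val (A := D) @` setT.
  rewrite eqEsubset; split=> [x xD|_ [i _ <-]]; last exact: enum_valP.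
  by exists (enum_rank_in xD x); rewrite ?enum_rankK_in.
rewrite (card_eqr card_II); apply: inj_card_eq => i j _ _; exact: enum_val_inj.
Qed.

(** Decides a goal that is a boolean identity in the truth values of the
    equations having z as their left-hand side. *)
Ltac case_eqs z :=
  repeat match goal with |- context [z == ?a] => case: (z == a) end; by [].

(** * Posets described by their flags *)

Section FlagModel.
Context {d : Order.disp_t} {P : tbPOrderType d} {X : Type}.

(** The elements of X name the flags of P: [face x i] is the i-th face of the
    flag x, counted from the least face, so that ranks are shifted by one, and
    [r i x] is the flag that differs from x in its face of rank i. Every chain
    of at most three proper faces lies in a named flag, whence no flag of P is
    missed. Once these properties are known, the flags of P and their adjacency
    can be replaced by X and r. *)
Record flag_model (r : 'I_3 -> X -> X) (rk : P -> nat) (face : X -> nat -> P) :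
    Prop := FlagModel {
  fm_lt : forall F G, F < G -> (rk F < rk G)%N;
  fm_le4 : forall F, (rk F <= 4)%N;
  fm_rk : forall x i, (i <= 4)%N -> rk (face x i) = i;
  fm_face : forall x i j, (i < j <= 4)%N -> face x i < face x j;
  fm_pair : forall F G, F <= G -> exists x, face x (rk F) = F /\ face x (rk G) = G;
  fm_triple : forall F E G, rk F = 1%N -> rk E = 2%N -> rk G = 3%N -> F < E < G ->
    exists x, [/\ face x 1%N = F, face x 2%N = E & face x 3%N = G];
  fm_adj : forall (i j : 'I_3) x, j != i -> face (r i x) j.+1 = face x j.+1;
  fm_adj_neq : forall (i : 'I_3) x, face (r i x) i.+1 <> face x i.+1;
  fm_diamond : forall (i : 'I_3) x y,
    (forall j : 'I_3, j != i -> face y j.+1 = face x j.+1) -> y = x \/ y = r i x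
}.

Context {r : 'I_3 -> X -> X} {rk : P -> nat} {face : X -> nat -> P}.
Hypothesis fm : flag_model r rk face.

Lemma face_inj x y : (forall i : 'I_3, face x i.+1 = face y i.+1) -> x = y.
Proof.
move=> xy; case: (fm_diamond fm (i := ord0) (x := y) (y := x)) => // xr.
by case: (fm_adj_neq fm (i := ord0) (x := y)); rewrite -xr xy.
Qed.

Lemma rk_eq F G : F >=< G -> rk F = rk G -> F = G.
Proof.
by case/comparable_ltgtP => // /(fm_lt fm) + FG; rewrite FG ltnn.
Qed.

Lemma face0 x : face x 0 = \bot.
Proof.
apply/eqP; rewrite eq_le le0x andbT; apply/negPn/negP => n.
have : \bot < face x 0 by rewrite lt0x; apply: contraNN n => /eqP->.
by move/(fm_lt fm); rewrite (fm_rk fm).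
Qed.

Lemma face4 x : face x 4 = \top.
Proof.
apply/eqP; rewrite eq_le lex1 /=; apply/negPn/negP => n.
have : face x 4 < \top by rewrite ltx1; apply: contraNN n => /eqP->.
by move/(fm_lt fm); rewrite (fm_rk fm)// ltnNge (fm_le4 fm).
Qed.

Lemma face_rk F : exists x, face x (rk F) = F.
Proof. by have [x [? _]] := fm_pair fm (lexx F); exists x. Qed.

Lemma face_le x i j : (i <= j <= 4)%N -> face x i <= face x j.
Proof.
rewrite leq_eqVlt => /andP[/predU1P[->//|ij j4]].
by apply/ltW/(fm_face fm); rewrite ij.
Qed.

Lemma face_comp x i j : (i <= 4)%N -> (j <= 4)%N -> face x i >=< face x j.
Proof.
move=> i4 j4; have [ij|ij] := leqP i j.
  by rewrite le_comparable ?face_le ?ij.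
by rewrite ge_comparable ?face_le ?(ltnW ij).
Qed.

Definition model_flag x : set P := [set face x i | i in `I_5].

Lemma model_flag_chain x : is_chain (model_flag x).
Proof. by move=> _ _ [i i4 <-] [j j4 <-]; exact: face_comp. Qed.

Lemma model_flag_rk x F : model_flag x F -> face x (rk F) = F.
Proof. by move=> [i i4 <-]; rewrite (fm_rk fm). Qed.

Lemma model_flagP x : is_flag (model_flag x).
Proof.
split=> [|C chC sC]; first exact: model_flag_chain.
rewrite eqEsubset; split=> // F CF; exists (rk F); first by rewrite /= ltnS (fm_le4 fm).
apply: rk_eq; last by rewrite (fm_rk fm)// (fm_le4 fm).
by apply: chC => //; apply: sC; exists (rk F); rewrite //= ltnS (fm_le4 fm).
Qed.

(** Two faces of a chain are equal as soon as they have the same rank, so it is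
    enough to treat separately the eight possible sets of ranks of the proper
    faces of C. *)
Lemma chain_sub_model C : is_chain C -> exists x, C `<=` model_flag x.
Proof.
move=> chC; pose occ i F := C F /\ rk F = i.
pose fits x i := forall F, occ i F -> face x i = F.
have sub x : fits x 1%N -> fits x 2%N -> fits x 3%N -> C `<=` model_flag x.
  move=> x1 x2 x3 F CF; exists (rk F); first by rewrite /= ltnS (fm_le4 fm).
  have : occ (rk F) F by [].
  have := fm_le4 fm F; case E : (rk F) => [|[|[|[|[|//]]]]] _ //; move=> oF.
  - apply: rk_eq; last by rewrite (fm_rk fm).
    by rewrite face0 le_comparable ?le0x.
  - exact: x1.
  - exact: x2.
  - exact: x3.
  - apply: rk_eq; last by rewrite (fm_rk fm).
    by rewrite face4 ge_comparable ?lex1.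
have hit i F x : occ i F -> face x i = F -> fits x i.
  move=> [CF rF] xF G [CG rG]; rewrite xF; apply: rk_eq; [exact: chC|by rewrite rF].
have miss i x : ~ (exists F, occ i F) -> fits x i.
  by move=> no F oF; case: no; exists F.
have lt i j F G : (i < j)%N -> occ i F -> occ j G -> F < G.
  move=> ij [CF rF] [CG rG]; have /comparable_ltgtP := chC _ _ CF CG.
  case=> //; first by move/(fm_lt fm); rewrite rF rG ltnNge (ltnW ij).
  by move=> FG; move: ij; rewrite -rF -rG FG ltnn.
have [[V V1]|nV] := pselect (exists V, occ 1%N V);
have [[E E2]|nE] := pselect (exists V, occ 2%N V);
have [[F F3]|nF] := pselect (exists V, occ 3%N V).
- have VEF : V < E < F by rewrite (lt 1%N 2%N)// (lt 2%N 3%N).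
  have [x [xV xE xF]] := fm_triple fm V1.2 E2.2 F3.2 VEF.
  by exists x; apply: sub; [exact: hit xV|exact: hit xE|exact: hit xF].
- have [x] := fm_pair fm (ltW (lt 1%N 2%N _ _ isT V1 E2)).
  rewrite V1.2 E2.2 => -[xV xE].
  by exists x; apply: sub; [exact: hit xV|exact: hit xE|exact: miss].
- have [x] := fm_pair fm (ltW (lt 1%N 3%N _ _ isT V1 F3)).
  rewrite V1.2 F3.2 => -[xV xF].
  by exists x; apply: sub; [exact: hit xV|exact: miss|exact: hit xF].
- have [x] := face_rk V; rewrite V1.2 => xV.
  by exists x; apply: sub; [exact: hit xV|exact: miss|exact: miss].
- have [x] := fm_pair fm (ltW (lt 2%N 3%N _ _ isT E2 F3)).
  rewrite E2.2 F3.2 => -[xE xF].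
  by exists x; apply: sub; [exact: miss|exact: hit xE|exact: hit xF].
- have [x] := face_rk E; rewrite E2.2 => xE.
  by exists x; apply: sub; [exact: miss|exact: hit xE|exact: miss].
- have [x] := face_rk F; rewrite F3.2 => xF.
  by exists x; apply: sub; [exact: miss|exact: miss|exact: hit xF].
- have [x _] := face_rk \bot.
  by exists x; apply: sub; exact: miss.
Qed.

Lemma flag_model_flag C : is_flag C -> exists x, C = model_flag x.
Proof.
move=> [chC maxC]; have [x Cx] := chain_sub_model chC.
by exists x; rewrite (maxC _ (@model_flag_chain x) Cx).
Qed.

Lemma face_injr x : {in `I_5 &, injective (face x)}.
Proof.
move=> i j; rewrite !inE /= => i5 j5 /(congr1 rk).
by rewrite !(fm_rk fm).
Qed.

Lemma face_lt_rk x i j : (i <= 4)%N -> (j <= 4)%N -> (face x i < face x j) = (i < j)%N.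
Proof.
move=> i4 j4; apply/idP/idP => [/(fm_lt fm)|ij]; first by rewrite !(fm_rk fm).
by apply: (fm_face fm); rewrite ij.
Qed.

(** The faces below a face in a flag are the faces of smaller index. *)
Lemma of_rankE i : (i < 4)%N -> of_rank i = [set F | rk F = i.+1].
Proof.
move=> i4; have below x k : (k <= 4)%N ->
    [set G | model_flag x G /\ G < face x k] #= `I_k.
  move=> k4; have -> : [set G | model_flag x G /\ G < face x k] = face x @` `I_k.
    rewrite eqEsubset; split=> [_ [[j j5 <-]]|_ [j jk <-]].
      by rewrite face_lt_rk// => jk; exists j.
    have j5 : (j < 5)%N by rewrite (leq_trans jk)// (leq_trans k4).
    by split; [exists j|rewrite face_lt_rk].
  apply: inj_card_eq => a b; rewrite !inE /= => ak bk.
  by apply: face_injr; rewrite inE /= (leq_trans _ (leq_trans k4 _)) // (leq_trans _ k4).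
rewrite eqEsubset; split=> [F [_ [/flag_model_flag[x ->] Fx]]|F rF].
  have [k k5 kF] := Fx; rewrite -{1}kF => H; rewrite -kF /= (fm_rk fm)//.
  by apply/card_eq_II; apply: (card_eq_trans _ H); rewrite card_eq_sym below.
have [x] := face_rk F; rewrite /= in rF; rewrite rF => xF.
exists (model_flag x); split; first exact: model_flagP.
  by exists i.+1.
by rewrite -{1}xF; apply: below.
Qed.

Definition flag_of x : flag P := SigSub (mem_set (model_flagP x)).

Lemma flag_of_surj Phi : exists x, Phi = flag_of x.
Proof.
have [x xP] := flag_model_flag (set_mem (valP Phi)).
by exists x; apply: val_inj.
Qed.

Lemma flag_of_inj : injective flag_of.
Proof.
move=> x y /(congr1 val) /= xy; apply: face_inj => i.
have : model_flag y (face x i.+1) by rewrite -xy; exists i.+1; rewrite //= !ltnS ltnW.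
move/model_flag_rk; rewrite (fm_rk fm)//.
by rewrite (leq_trans (ltn_ord i)).
Qed.

(** Flags that agree away from rank i agree in the two other proper ranks, so
    this is the diamond property. *)
Lemma i_adjacent_flag_of i x y :
  i_adjacent i (flag_of x) (flag_of y) <-> y = r i x.
Proof.
have ord4 (k : 'I_3) : (k.+1 <= 4)%N by rewrite (leq_trans (ltn_ord k)).
rewrite /i_adjacent; have -> /= : of_rank i = [set F : P | rk F = i.+1].
  by rewrite of_rankE// (leq_trans (ltn_ord i)).
split=> [[xy E]|->].
  have [||//] := fm_diamond fm (i := i) (x := x) (y := y) => [j ji|yx]; last first.
    by case: xy; rewrite yx.
  have : (model_flag y `\` [set F | rk F = i.+1]) (face x j.+1).
    rewrite -E; split; first by exists j.+1; rewrite //= ltnS.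
    by rewrite /= (fm_rk fm)// => -[] /val_inj /eqP; rewrite (negPf ji).
  by case=> /model_flag_rk + _; rewrite (fm_rk fm).
split=> [/flag_of_inj /(congr1 (face^~ i.+1))|]; first by move/esym/(fm_adj_neq fm).
suff eqf k : (k <= 4)%N -> k != i.+1 -> face (r i x) k = face x k.
  rewrite eqEsubset; split=> _ [[k k5 <-] /= kn]; rewrite (fm_rk fm) in kn => //;
    (split; last by rewrite /= (fm_rk fm)); exists k => //.
    by rewrite eqf//; apply/eqP.
  by rewrite eqf//; apply/eqP.
case: k => [|k] k4 ki; first by rewrite !face0.
have := k4; rewrite leq_eqVlt => /predU1P[->|k3]; first by rewrite !face4.
have k3' : (k < 3)%N by [].
by have /= -> // := fm_adj fm (i := i) (j := Ordinal k3') x; apply: contraNN ki => /eqP <-.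
Qed.

Lemma i_adjacent_flag_ofE i x Phi :
  i_adjacent i (flag_of x) Phi <-> Phi = flag_of (r i x).
Proof.
have [y ->] := flag_of_surj Phi; rewrite i_adjacent_flag_of.
by split=> [->//|/flag_of_inj].
Qed.

Lemma flagP2 (C : set P) : is_flag C -> [/\ C \bot, C \top & C #= `I_5].
Proof.
move=> /flag_model_flag[x ->]; split.
- by exists 0%N; rewrite ?face0.
- by exists 4%N; rewrite ?face4.
- by apply: inj_card_eq; exact: face_injr.
Qed.

End FlagModel.

Section Iso.
Context {d d' : Order.disp_t} {P : tbPOrderType d} {Q : tbPOrderType d'} {X : Type}.
Context {r : 'I_3 -> X -> X} {rk : P -> nat} {face : X -> nat -> P}.

Lemma flag_model_iso (f : P -> Q) (g : Q -> P) : flag_model r rk face ->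
  cancel f g -> cancel g f -> {mono f : x y / x <= y} ->
  flag_model r (rk \o g) (fun x i => f (face x i)).
Proof.
move=> fm fK gK mf.
have mlt : {mono f : x y / x < y} by apply: leW_mono.
have mg : {mono g : x y / x <= y} by move=> x y; rewrite -mf !gK.
have mglt : {mono g : x y / x < y} by apply: leW_mono.
split=> /=.
- by move=> F G FG; apply: (fm_lt fm); rewrite mglt.
- by move=> F; apply: (fm_le4 fm).
- by move=> x i i4; rewrite fK (fm_rk fm).
- by move=> x i j ij; rewrite mlt (fm_face fm).
- move=> F G; rewrite -mg => /(fm_pair fm)[x [xF xG]].
  by exists x; rewrite xF xG !gK.
- move=> F E G rF rE rG; rewrite -!mglt => /(fm_triple fm rF rE rG)[x [xF xE xG]].
  by exists x; rewrite xF xE xG !gK.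
- by move=> i j x ji; rewrite (fm_adj fm).
- by move=> i x /(can_inj fK); exact: (fm_adj_neq fm).
- by move=> i x y H; apply: (fm_diamond fm) => j ji; apply: (can_inj fK); exact: H.
Qed.
End Iso.

Section Diamond.
Context {d : Order.disp_t} {P : tbPOrderType d} {X : Type}.
Context {r : 'I_3 -> X -> X} {rk : P -> nat} {face : X -> nat -> P}.
Hypothesis fm : flag_model r rk face.

Lemma adj_other (i : 'I_3) k x : (k <= 4)%N -> k != i.+1 -> face (r i x) k = face x k.
Proof.
case: k => [|k] k4 ki; first by rewrite !(face0 fm).
have := k4; rewrite leq_eqVlt => /predU1P[->|k3]; first by rewrite !(face4 fm).
have k3' : (k < 3)%N by [].
by have /= -> // := fm_adj fm (i := i) (j := Ordinal k3') x; apply: contraNN ki => /eqP <-.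
Qed.

(** A face between those of ranks i - 1 and i + 1 of x completes them to a
    flag, which is x or r i x. *)
Lemma diamond_rank (i : 'I_3) x F : rk F = i.+1 -> face x i < F -> F < face x i.+2 ->
  F = face x i.+1 \/ F = face (r i x) i.+1.
Proof.
move=> rF lF Fl.
suff [y [yF yx]] : exists y, face y i.+1 = F /\
    forall j : 'I_3, j != i -> face y j.+1 = face x j.+1.
  by have [<-|<-] := fm_diamond fm yx; rewrite yF; [left|right].
have V := @fm_triple _ _ _ _ _ _ fm.
have rkx := fm_rk fm; have lt := fm_face fm.
move: i rF lF Fl; apply: ord3_case => /= rF lF Fl.
- have [||||y [y1 y2 y3]] := V F (face x 2) (face x 3); rewrite ?rkx ?Fl ?lt//.
  by exists y; split=> //; apply: ord3_case.
- have [||||y [y1 y2 y3]] := V (face x 1) F (face x 3); rewrite ?rkx ?Fl ?lF ?lt//.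
  by exists y; split=> //; apply: ord3_case.
- have [||||y [y1 y2 y3]] := V (face x 1) (face x 2) F; rewrite ?rkx ?lF ?lt//.
  by exists y; split=> //; apply: ord3_case.
Qed.

(** All the conditions of the diamond axiom of a polyhedron have this form: for
    the vertices or the faces at an edge, one of the two bounds is improper. *)
Lemma diamond_card (i : 'I_3) x (A : set P) :
  (forall F, A F <-> [/\ rk F = i.+1, face x i < F & F < face x i.+2]) -> A #= `I_2.
Proof.
have i3 := ltn_ord i; move=> AP.
suff -> : A = [set face x i.+1; face (r i x) i.+1].
  by apply: card_set2 => /esym; exact: (fm_adj_neq fm).
rewrite eqEsubset; split=> F.
  by move/AP => [rF lF Fl]; exact: diamond_rank.
move=> FE; apply/AP; split.
- by case: FE => ->; apply: (fm_rk fm); lia.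
- have ri : face (r i x) i = face x i by apply: adj_other; lia.
  by case: FE => ->; [|rewrite -ri]; apply: (fm_face fm); lia.
- have ri : face (r i x) i.+2 = face x i.+2 by apply: adj_other; lia.
  by case: FE => ->; [|rewrite -ri]; apply: (fm_face fm); lia.
Qed.

Lemma rk_comp_lt (F G : P) : (rk F < rk G)%N -> (F >=< G) = (F < G).
Proof.
move=> FG; apply/idP/idP => [/comparable_ltgtP[//|/(fm_lt fm)|FG']|/ltW/le_comparable//].
  by rewrite ltnNge (ltnW FG).
by move: FG; rewrite FG' ltnn.
Qed.

Lemma edge_diamonds (E : P) : of_rank 1 E ->
  [set V | of_rank 0 V /\ V >=< E] #= `I_2 /\
  [set F | of_rank 2 F /\ F >=< E] #= `I_2.
Proof.
rewrite !(of_rankE fm)// => rE; have [x] := face_rk fm E; rewrite rE => xE.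
split.
- apply: (@diamond_card o0 x) => F /=; rewrite xE (face0 fm).
  split=> [[rF]|[rF _ FE]]; last by rewrite rF lt_comparable.
  rewrite rk_comp_lt ?rF ?rE// => FE; split=> //.
  by rewrite lt0x; apply: contra_eq_neq rF => ->; rewrite -(face0 fm x) (fm_rk fm).
- apply: (@diamond_card o2 x) => F /=; rewrite xE (face4 fm).
  split=> [[rF]|[rF EF _]]; last by rewrite rF comparable_sym lt_comparable.
  rewrite comparable_sym rk_comp_lt ?rF ?rE// => FE; split=> //.
  by rewrite ltx1; apply: contra_eq_neq rF => ->; rewrite -(face4 fm x) (fm_rk fm).
Qed.

Lemma vertex_face_diamond (V F : P) : of_rank 0 V -> of_rank 2 F -> V >=< F ->
  [set E | [/\ of_rank 1 E, E >=< V & E >=< F]] #= `I_2.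
Proof.
rewrite !(of_rankE fm)//= => rV rF; rewrite rk_comp_lt ?rV ?rF// => /ltW.
move=> /(fm_pair fm)[x]; rewrite rV rF => -[xV xF].
apply: (@diamond_card o1 x) => E /=; rewrite xV xF.
split=> [[rE]|[rE VE EF]]; last by rewrite rE comparable_sym !lt_comparable.
by rewrite comparable_sym !rk_comp_lt ?rE ?rV ?rF.
Qed.

End Diamond.

(** * Monodromy groups of finite posets *)

Section FiniteModel.
Context {d : Order.disp_t} {P : tbPOrderType d} {X : finType}.
Context {r : 'I_3 -> {perm X}} {rk : P -> nat} {face : X -> nat -> P}.
Hypothesis fm : flag_model (fun i => r i) rk face.

Let fo := flag_of fm.
(** The inverse of [flag_of]; with it, the permutations of the flags of P become
    permutations of the finite type X. *)
Definition flag_index Phi : X := projT1 (cid (flag_of_surj fm Phi)).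

Lemma flag_indexK : cancel flag_index fo.
Proof. by move=> Phi; rewrite /flag_index; case: cid. Qed.

Lemma flag_ofK : cancel fo flag_index.
Proof. by move=> x; apply: (flag_of_inj (fm := fm)); apply: flag_indexK. Qed.

Lemma sym_of_perm_subproof (g : {perm X}) :
  `[< bijective (fun Phi => fo (g (flag_index Phi))) >].
Proof.
apply/asboolP; exists (fun Phi => fo (g^-1%g (flag_index Phi))) => Phi.
  by rewrite flag_ofK permK flag_indexK.
by rewrite flag_ofK permKV flag_indexK.
Qed.

Definition sym_of_perm g : sym (flag P) := Defs.Sym (sym_of_perm_subproof g).

Lemma sym_of_permM g h : sym_of_perm (g * h)%g = (sym_of_perm g * sym_of_perm h)%g.
Proof. by apply/val_inj/funext => Phi /=; rewrite flag_ofK permM. Qed.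

Lemma sym_of_perm1 : sym_of_perm 1%g = 1%g.
Proof. by apply/val_inj/funext => Phi /=; rewrite perm1 flag_indexK. Qed.

Lemma sym_bij (T : choiceType) (s : sym T) : bijective s.
Proof. exact/asboolP/symP. Qed.

Lemma perm_of_sym_subproof (s : sym (flag P)) : injective (fun x => flag_index (s (fo x))).
Proof.
move=> x y /(can_inj flag_indexK) /(bij_inj (sym_bij s)); exact: flag_of_inj.
Qed.

Definition perm_of_sym s : {perm X} := perm (@perm_of_sym_subproof s).

Lemma perm_of_symM s t : perm_of_sym (s * t)%g = (perm_of_sym s * perm_of_sym t)%g.
Proof. by apply/permP => x; rewrite permM !permE /= flag_indexK. Qed.

Lemma perm_of_sym1 : perm_of_sym 1%g = 1%g.
Proof. by apply/permP => x; rewrite perm1 !permE /= flag_ofK. Qed.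

Lemma sym_of_permK g : perm_of_sym (sym_of_perm g) = g.
Proof. by apply/permP => x; rewrite permE /= !flag_ofK. Qed.

(** The adjacent flag is unique, so that the choice made in [mon_generator] is
    forced. *)
Lemma mon_generatorE i : mon_generator P i = sym_of_perm (r i).
Proof.
rewrite /mon_generator.
have E : forall s : sym (flag P), (forall Psi, i_adjacent i Psi (s Psi)) -> s = sym_of_perm (r i).
  move=> s sP; apply/val_inj/funext => Phi /=.
  by have := sP Phi; rewrite -{1}[Phi]flag_indexK => /i_adjacent_flag_ofE.
apply: xget_unique => // Psi /=.
by rewrite -{1}[Psi]flag_indexK; apply/i_adjacent_flag_ofE.
Qed.

Definition flag_group : {group {perm X}} := <<[set r i | i : 'I_3]%SET>>%G.

Lemma monodromy_group_sym_of_perm g : g \in flag_group -> monodromy_group (sym_of_perm g).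
Proof.
move=> gG A [[A1 AV] genA]; move: g gG; apply: gen_ind => [|x _ Ax /imsetP[i _ ->]].
  by rewrite sym_of_perm1.
have -> : sym_of_perm (x * r i)%g = (sym_of_perm x * (1 * (sym_of_perm (r i))^-1)^-1)%g.
  by rewrite sym_of_permM mul1g invgK.
by apply: (AV) => //; apply: (AV) => //; apply: genA; exists i; rewrite // mon_generatorE.
Qed.

Lemma perm_of_monodromy s : monodromy_group s -> perm_of_sym s \in flag_group.
Proof.
move/(_ [set s | perm_of_sym s \in flag_group]); apply; split.
  split=> [|x y /= xG yG]; first by rewrite /= perm_of_sym1 group1.
  have -> : perm_of_sym (x * y^-1)%g = (perm_of_sym x * (perm_of_sym y)^-1)%g.
    by apply: (mulIg (perm_of_sym y)); rewrite -perm_of_symM !mulgKV.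
  by rewrite groupM ?groupV.
by move=> _ [i _ <-] /=; rewrite mon_generatorE sym_of_permK mem_gen// imset_f.
Qed.

End FiniteModel.

(** * The surface of a poset *)

Section Triangle.
Variable R : realType.
Local Open Scope ring_scope.
Local Notation triangle := (@triangle R).

Lemma triangle_ge0 (x : 'rV[R]_3) i : triangle x -> 0 <= x 0 i.
Proof. by case. Qed.

Lemma triangle_le1 (x : 'rV[R]_3) i : triangle x -> x 0 i <= 1.
Proof.
move=> [x0 <-]; rewrite (bigD1 i)//= lerDl sumr_ge0// => j _; exact: x0.
Qed.

Definition corner (k : 'I_3) : 'rV[R]_3 := delta_mx 0 k.

Lemma triangle_corner k : triangle (corner k).
Proof.
split=> [i|]; first by rewrite mxE ler0n.
rewrite (bigD1 k)//= mxE !eqxx big1 ?addr0// => i ik.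
by rewrite mxE (negPf ik) andbF.
Qed.

Lemma triangle_compact : compact triangle.
Proof.
apply: bounded_closed_compact.
  exists 1; split; first exact: num_real.
  move=> M M1 x tx; rewrite /= (le_trans _ (ltW M1))//.
  rewrite /Num.norm /= mx_normrE; apply/bigmax_leP; split=> // -[a b] _ /=.
  by rewrite (ord1 a) ger0_norm ?triangle_le1 ?triangle_ge0.
have -> : triangle = (\bigcap_(i in [set: 'I_3]) ((fun x : 'rV[R]_3 => x 0 i) @^-1` [set y | 0 <= y]))
     `&` ((fun x : 'rV[R]_3 => \sum_i x 0 i) @^-1` [set 1]).
  by rewrite eqEsubset; split=> x [x0 x1]; split=> // i *; exact: x0.
apply: closedI.
  apply: closed_bigI => i _; apply: preimage_closed; last exact: closed_ge.
  by move=> x _; exact: coord_continuous.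
apply: preimage_closed; last exact: closed_eq.
move=> x _; apply: (@cvg_big _ _ _ _ _ _ _ (nbhs x)) => [|i _]; first exact: add_continuous.
exact: coord_continuous.
Qed.

(** The triangle is the union of the segments that start at one corner. *)
Lemma triangle_connected : connected triangle.
Proof.
pose path x (t : R) : 'rV[R]_3 := corner 0 + t *: (x - corner 0).
have -> : triangle = \bigcup_(x in triangle) (path x @` `[0, 1]).
  rewrite eqEsubset; split=> [x tx|_ [x tx] [t] /= /[!in_itv]/= /andP[t0 t1] <-].
    by exists x => //; exists 1; rewrite /= ?in_itv/= ?ler01 ?lexx// /path scale1r addrC subrK.
  have pE i : path x t 0 i = (1 - t) * corner 0 0 i + t * x 0 i.
    by rewrite !mxE; ring.
  split=> [i|].
    by rewrite pE addr_ge0// mulr_ge0 ?subr_ge0//; [exact: (triangle_corner 0).1|exact: tx.1].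
  under eq_bigr do rewrite pE; rewrite big_split/= -!mulr_sumr.
  by rewrite (triangle_corner 0).2 tx.2 !mulr1 subrK.
apply: bigcup_connected.
  by exists (corner 0) => x _; exists 0; rewrite /= ?in_itv/= ?ler01 ?lexx// /path scale0r addr0.
move=> x _; apply: connected_continuous_connected; first exact: segment_connected.
apply: continuous_subspaceT => t.
apply: cvgD; first exact: cvg_cst.
exact: scalel_continuous.
Qed.

End Triangle.

Section SetType.
Context {T : topologicalType} (A : set T) (a0 : set_type A).

Let f (x : T) : set_type A := insubd a0 x.

(** Compactness and connectedness of a subset are transferred to the subset seen
    as a space by its retraction [insubd]. *)
Lemma insubd_within_continuous : {within A, continuous f}.
Proof.
rewrite continuous_subspace_in => x /[!inE] Ax U.
have fx : f x = SigSub (mem_set Ax) by apply: val_inj; rewrite insubdK//; exact: mem_set.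
rewrite /from_subspace fx => /subspace_subtypeP; rewrite /= set_valE/=; apply: filterS => _ [y Uy <-] /=.
by rewrite /f valKd.
Qed.

Lemma image_insubd : f @` A = setT.
Proof.
rewrite eqEsubset; split=> // x _; exists (val x); first exact: set_valP.
by rewrite /f valKd.
Qed.

Lemma set_type_compact : compact A -> compact [set: set_type A].
Proof.
by move=> cA; rewrite -image_insubd; apply: continuous_compact => //; exact: insubd_within_continuous.
Qed.

Lemma set_type_connected : connected A -> connected [set: set_type A].
Proof.
by move=> cA; rewrite -image_insubd; apply: connected_continuous_connected => //; exact: insubd_within_continuous.
Qed.
End SetType.

Section Surface.
Context {R : realType} {d : Order.disp_t} {P : tbPOrderType d} {X : finType}.
Context {r : 'I_3 -> {perm X}} {rk : P -> nat} {face : X -> nat -> P}.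
Hypothesis fm : flag_model (fun i => r i) rk face.

(** Gluing along a side reverses the direction of that side when the two
    triangles have opposite cyclic orders of their corners. *)
Lemma orientable_model (o : X -> bool) : (forall i x, o (r i x) = ~~ o x) -> orientable P.
Proof.
move=> oP; exists (o \o flag_index fm) => i Phi Psi.
rewrite -[Phi](flag_indexK fm) -[Psi](flag_indexK fm).
move/i_adjacent_flag_of => -> j k _ _ /=; rewrite !flag_ofK oP.
by case: (o _) => /= <-; rewrite /next_corner /= ?ordSK ?ord_predK.
Qed.

Lemma finite_flags : finite_set [set: flag P].
Proof.
have -> : [set: flag P] = flag_of fm @` [set: X].
  by rewrite eqEsubset; split=> // Phi _; have [x ->] := flag_of_surj fm Phi; exists x.
exact/finite_image/finite_finset.
Qed.

Let S := surface R P.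
Let quo : triangles R P -> S := \pi_S%qT.

Let origin : set_type (@triangle R) := SigSub (mem_set (triangle_corner R ord0)).

Lemma surface_image : [set: S] = quo @` setT.
Proof. by rewrite eqEsubset; split=> // x _; exists (repr x) => //; exact: reprK. Qed.

Lemma quo_continuous : continuous quo.
Proof. exact: pi_continuous. Qed.

Lemma surface_compact : compact [set: S].
Proof.
rewrite surface_image; apply: continuous_compact.
  by apply: continuous_subspaceT => x; exact: quo_continuous.
apply: sigT_compact; first exact: finite_flags.
by move=> _; apply: set_type_compact => //; exact: triangle_compact.
Qed.

Let tile (x : X) : set S := (fun p => quo (existT _ (flag_of fm x) p)) @` setT.

Lemma tile_connected x : connected (tile x).
Proof.
apply: connected_continuous_connected.
  by apply: set_type_connected => //; exact: triangle_connected.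
apply: continuous_subspaceT => p.
apply: continuous_comp; [exact: existT_continuous|exact: quo_continuous].
Qed.

(** A corner other than i lies on the side opposite to the corner i, along which
    the two triangles are glued. *)
Lemma tile_meet i x : tile x `&` tile (r i x) !=set0.
Proof.
have [k ki] : exists k : 'I_3, k != i by exists (ordS i); case: i => -[|[|[|//]]].
pose p : set_type (@triangle R) := SigSub (mem_set (triangle_corner R k)).
exists (quo (existT _ (flag_of fm x) p)); split; first by exists p.
exists p => //; apply/esym/(@eqquotP _ _ {eq_quot (@glued R d P)}%qT).
apply/asboolP/rst_step.
exists i; split=> //=; first exact/i_adjacent_flag_of.
by rewrite mxE eqxx /= eq_sym (negPf ki).
Qed.

(** Successive triangles along a word in the r_i have a point in common. *)
Lemma surface_connected :
  (forall x y, exists2 g, g \in flag_group (r := r) & g x = y) -> connected [set: S].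
Proof.
move=> tr; have tile_link x g : g \in flag_group (r := r) ->
    exists C, [/\ connected C, tile x `<=` C & tile (g x) `<=` C].
  move: g; apply: gen_ind => [|g _ [C [cC xC gC]] /imsetP[i _ ->]].
    by exists (tile x); split; rewrite ?perm1//; exact: tile_connected.
  exists (C `|` tile ((g * r i)%g x)); split.
  - apply: connectedU => //; last exact: tile_connected.
    by rewrite permM; have [p [p1 p2]] := tile_meet i (g x); exists p; split=> //; exact: gC.
  - by move=> p /xC; left.
  - by move=> p; right.
have [x _] := face_rk fm \bot.
pose p0 : S := quo (existT _ (flag_of fm x) origin).
have -> : [set: S] = connected_component setT p0.
  rewrite eqEsubset; split=> // q _; rewrite -(reprK q).
  case: (repr q) => Psi p; have [y ->] := flag_of_surj fm Psi.
  have [g gG <-] := tr x y; have [C [cC xC gC]] := tile_link x g gG.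
  by exists C; [split=> //; apply: xC; exists origin|apply: gC; exists p].
exact: component_connected.
Qed.

End Surface.

(** * The coset poset of a string C-group *)

Section StringC.
Variable gT : finGroupType.
Local Open Scope group_scope.

(** The stabilizer of the face of index k of a base flag: the rho_j that
    generate it are those that change another face. For the indices 0 and 4 of
    the improper faces it is the whole group. *)
Definition parabolic (rho : 'I_3 -> gT) (k : nat) : {group gT} :=
  <<[set rho j | j : 'I_3 & j.+1 != k]%SET>>%G.

(** For three generators, the intersection property of string C-groups reduces
    to the last two conditions. *)
Record string_C_group := StringC {
  sgen :> 'I_3 -> gT;
  sgen_gen : <<[set sgen j | j : 'I_3]%SET>> = [set: gT]%SET;
  sgen_inv : forall i, sgen i * sgen i = 1;
  sgen_comm : commute (sgen o0) (sgen o2);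
  sgen_notin : forall i, sgen i \notin parabolic sgen i.+1;
  sgen_cap : forall w, w \in parabolic sgen 1 -> w \in parabolic sgen 3 ->
    w = 1 \/ w = sgen o1
}.

Variable S : string_C_group.
Notation H := (parabolic S).

Lemma sgen_in (j : 'I_3) k : j.+1 != k -> S j \in H k.
Proof. by move=> jk; apply/mem_gen/imset_f; rewrite inE. Qed.

Lemma parabolicT k : (k == 0%N) || (3 < k)%N -> H k = [set: gT]%SET :> {set gT}.
Proof.
move=> k0; rewrite -(sgen_gen S); congr (<<_>>); apply/setP => x.
apply/imsetP/imsetP => -[j _ ->]; exists j => //; rewrite inE.
by have := ltn_ord j; lia.
Qed.

(** Since rho_0 and rho_2 are commuting involutions. *)
Lemma edge_parabolic w : w \in H 2 ->
  exists u v, [/\ w = u * v, u = 1 \/ u = S o2 & v = 1 \/ v = S o0].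
Proof.
have s02 : S o0 * S o2 = S o2 * S o0 by exact: sgen_comm.
move: w; apply: gen_ind => [|w _ + /imsetP[j + ->]].
  by exists 1, 1; split; [rewrite mulg1|left|left].
move=> [u [v [-> uE vE]]]; move: j; apply: ord3_case; rewrite !inE //= => _.
- exists u, (v * S o0); split=> //; first by rewrite mulgA.
  by case: vE => ->; [right; rewrite mul1g|left; rewrite sgen_inv].
- exists (u * S o2), v; split=> //; last first.
    by case: uE => ->; [right; rewrite mul1g|left; rewrite sgen_inv].
  by case: vE => ->; rewrite ?mulg1// -!mulgA s02.
Qed.

(** A face is a rank together with a left coset of the stabilizer of that rank;
    the rank is part of the data because stabilizers of different ranks may
    have a coset in common. *)
Definition is_coset_face (p : 'I_5 * {set gT}) :=
  [exists x, p.2 == x *: H p.1].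

Definition coset_face := {p | is_coset_face p}.

HB.instance Definition _ := SubChoice.on coset_face.
HB.instance Definition _ := [Finite of coset_face by <:].

Definition frank (F : coset_face) : nat := (val F).1.

Lemma frank_le4 F : (frank F <= 4)%N.
Proof. by have := ltn_ord (val F).1. Qed.

Lemma is_coset_face_mk x (i : 'I_5) : is_coset_face (i, x *: H i).
Proof. by apply/existsP; exists x. Qed.

Definition mkface x (i : nat) : coset_face := Sub _ (is_coset_face_mk x (inord i)).

Lemma frank_mk x i : (i <= 4)%N -> frank (mkface x i) = i.
Proof. by move=> i4; rewrite /frank /= inordK. Qed.

Lemma mkface_frank F : exists x, F = mkface x (frank F).
Proof.
case: F => -[i A] FP; have /existsP[x /= /eqP Ax] := FP; exists x; apply: val_inj => /=.
by rewrite /frank /= inord_val -Ax.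
Qed.

Lemma mkfaceP x y i : (i <= 4)%N -> (mkface x i = mkface y i) <-> (x^-1 * y \in H i).
Proof.
move=> i4; split=> [/(congr1 val) [] |xy].
  by rewrite inordK// => /lcoset_eqP; rewrite mem_lcoset => h; rewrite -groupV invMg invgK.
apply: val_inj => /=; congr pair; rewrite inordK//; apply/esym/lcoset_eqP.
by rewrite mem_lcoset.
Qed.

(** Cosets are incident when they meet; z is a common element. *)
Definition fle F G := (frank F <= frank G)%N &&
  [exists z, (F == mkface z (frank F)) && (G == mkface z (frank G))].

Lemma fleP F G : reflect ((frank F <= frank G)%N /\
  exists z, F = mkface z (frank F) /\ G = mkface z (frank G)) (fle F G).
Proof.
apply: (iffP andP) => -[FG].
  by move=> /existsP[z /andP[/eqP zF /eqP zG]]; split=> //; exists z.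
by move=> [z [zF zG]]; split=> //; apply/existsP; exists z; rewrite -zF -zG !eqxx.
Qed.

(** The stabilizer of an edge is the product of its intersections with the
    stabilizers of a vertex and of a face, by [edge_parabolic]. This gives both
    the transitivity of incidence and an element common to the three cosets of a
    chain. *)
Lemma common_rep z w i j k : (i <= j)%N -> (j <= k)%N -> (k <= 4)%N ->
  mkface z j = mkface w j ->
  exists u, [/\ mkface u i = mkface z i, mkface u j = mkface z j & mkface u k = mkface w k].
Proof.
move=> ij jk k4 zw.
have j4 := leq_trans jk k4; have i4 := leq_trans ij j4.
have [ij'|] := eqVneq i j; first by exists w; rewrite ij' zw.
have [jk'|] := eqVneq j k; first by exists z; rewrite -jk' zw.
have [i0|] := posnP i; first by exists w; split=> //; apply/mkfaceP; rewrite ?i0// parabolicT ?inE.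
have [k3|] := ltnP 3 k; first by exists z; split=> //; apply/mkfaceP; rewrite ?k3// parabolicT ?inE//= k3 orbT.
move=> k3 i1 nij njk. have [? ? ?] : [/\ i = 1, j = 2 & k = 3]%N by split; lia.
subst i j k; move/mkfaceP: zw => /(_ isT)/edge_parabolic[u [v [zwE uE vE]]].
have uH k : (k <= 2)%N -> u \in H k.
  by move=> k2; case: uE => ->; rewrite ?group1// sgen_in//=; lia.
have vH : v \in H 3 by case: vE => ->; rewrite ?group1// sgen_in.
exists (z * u); split; apply/mkfaceP => //.
- by rewrite invMg mulgKV groupV uH.
- by rewrite invMg mulgKV groupV uH.
- by rewrite invMg -mulgA zwE mulKg.
Qed.

Lemma fle_refl : reflexive fle.
Proof. by move=> F; apply/fleP; split=> //; have [x xF] := mkface_frank F; exists x. Qed.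

Lemma fle_anti : antisymmetric fle.
Proof.
move=> F G /andP[/fleP[FG [z [zF zG]]] /fleP[GF _]].
by rewrite zF zG; congr mkface; apply/eqP; rewrite eqn_leq FG.
Qed.

Lemma fle_trans : transitive fle.
Proof.
move=> G F K /fleP[FG [z [zF zG]]] /fleP[GK [w [wG wK]]]; apply/fleP.
split; first exact: leq_trans GK.
have [|u [uF _ uK]] := common_rep FG GK (frank_le4 K) (z := z) (w := w).
  by rewrite -zG.
by exists u; rewrite uF uK.
Qed.

Fact coset_face_display : Order.disp_t. Proof. exact: (Order.Disp tt tt). Qed.

HB.instance Definition _ := Order.Le_isPOrder.Build coset_face_display coset_face
  fle_refl fle_anti fle_trans.

Lemma fle_bot F : mkface 1 0 <= F.
Proof.
apply/fleP; rewrite frank_mk//; split=> //; have [x xF] := mkface_frank F.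
by exists x; split=> //; apply/mkfaceP; rewrite // parabolicT ?inE.
Qed.

Lemma fle_top F : F <= mkface 1 4.
Proof.
apply/fleP; rewrite frank_mk//; split; first exact: frank_le4.
have [x xF] := mkface_frank F.
by exists x; split=> //; apply/mkfaceP; rewrite // parabolicT ?inE.
Qed.

HB.instance Definition _ :=
  Order.hasBottom.Build coset_face_display coset_face fle_bot.
HB.instance Definition _ :=
  Order.hasTop.Build coset_face_display coset_face fle_top.

Definition rmul (i : 'I_3) : {perm gT} := perm (mulIg (S i)).

Lemma rmulE i x : rmul i x = x * S i. Proof. exact: permE. Qed.

Lemma mkface_lt x i j : (i < j <= 4)%N -> mkface x i < mkface x j.
Proof.
move=> /andP[ij j4]; have i4 : (i <= 4)%N by lia.
rewrite lt_neqAle; apply/andP; split.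
  by apply: contraTneq ij => /(congr1 frank); rewrite !frank_mk// => ->; rewrite ltnn.
by apply/fleP; rewrite !frank_mk//; split; [exact: ltnW|exists x].
Qed.

Lemma fle_common F E G : F <= E -> E <= G ->
  exists u, [/\ mkface u (frank F) = F, mkface u (frank E) = E & mkface u (frank G) = G].
Proof.
move=> /fleP[FE [z [zF zE]]] /fleP[EG [w [wE wG]]].
have [|u [uF uE uG]] := common_rep FE EG (frank_le4 G) (z := z) (w := w); first by rewrite -zE.
by exists u; rewrite uF uE uG.
Qed.

(** The element x of the group names the flag of the three cosets of x. Two
    elements with two cosets in common differ by an element of the intersection
    of two stabilizers, which has at most two elements. *)
Lemma coset_flag_model : flag_model (fun i => rmul i) frank mkface.
Proof.
split.
- move=> F G; rewrite lt_neqAle => /andP[FG /fleP[]].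
  rewrite leq_eqVlt => /predU1P[e|//] [z [zF zG]].
  by case/eqP: FG; rewrite zF zG e.
- exact: frank_le4.
- exact: frank_mk.
- exact: mkface_lt.
- by move=> F G /fle_common /(_ (lexx _))[u [uF _ uG]]; exists u.
- move=> F E G rF rE rG /andP[/ltW FE /ltW EG]; have [u] := fle_common FE EG.
  by rewrite rF rE rG; exists u.
- move=> i j x ji; apply/(mkfaceP _ _ (leqW (ltn_ord j))).
  by rewrite rmulE invMg mulgKV groupV sgen_in// eqSS eq_sym.
- move=> i x /(mkfaceP _ _ (leqW (ltn_ord i))); rewrite rmulE invMg mulgKV groupV.
  exact/negP/sgen_notin.
- move=> i x y xy; rewrite rmulE.
  have {}xy (j : 'I_3) : j != i -> x^-1 * y \in H j.+1.
    by move=> /xy e; apply/(mkfaceP _ _ (leqW (ltn_ord j))).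
  suff: x^-1 * y = 1 \/ x^-1 * y = S i.
    by move=> [/eqP|<-]; [rewrite -eq_mulVg1 => /eqP; left|right; rewrite mulKVg].
  move: i xy; apply: ord3_case => xy.
  + have w2 := xy o1 isT; have w3 := xy o2 isT.
    have [u [v [wE uE vE]]] := edge_parabolic w2.
    have v3 : v \in H 3 by case: vE => ->; rewrite ?group1// sgen_in.
    case: uE => uE; first by rewrite wE uE mul1g.
    by have := sgen_notin S o2; rewrite -uE -(groupMr _ v3) -wE w3.
  + have w1 := xy o0 isT; have w3 := xy o2 isT; exact: sgen_cap.
  + have w1 := xy o0 isT; have w2 := xy o1 isT.
    have [u [v [wE uE vE]]] := edge_parabolic w2.
    have u1 : u \in H 1 by case: uE => ->; rewrite ?group1// sgen_in.
    case: vE => vE; first by rewrite wE vE mulg1.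
    by have := sgen_notin S o0; rewrite -vE -(groupMl _ u1) -wE w1.
Qed.

End StringC.

Section CosetPolyhedron.
Variables (gT : finGroupType) (S : string_C_group gT).
Local Open Scope group_scope.
Local Notation H := (parabolic S).
Local Notation mk := (mkface S).
Let fm := coset_flag_model S.

Lemma mk_le x i j : (i <= j <= 4)%N -> (mk x i <= mk x j)%O.
Proof. exact: (face_le fm). Qed.

Lemma mk_comp x (i j : nat) : (i <= 4)%N -> (j <= 4)%N -> (mk x i >=< mk x j)%O.
Proof. exact: (face_comp fm). Qed.

Lemma proper_mk x i j k : (i < k < j)%N -> (j <= 4)%N ->
  proper_faces (mk x i) (mk x j) (mk x k).
Proof. by move=> ikj j4; rewrite /proper_faces /=; apply/andP; split; apply: (fm_face fm); lia. Qed.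

(** A section whose rank is at least 2 has an improper bound, so the stabilizer
    of its two bounds is the stabilizer of one face. *)
Lemma parabolic_section x y i j : (i.+2 < j <= 4)%N ->
  mk x i = mk y i -> mk x j = mk y j ->
  x^-1 * y \in <<[set S a | a : 'I_3 & i < a.+1 < j]%SET>>.
Proof.
move=> /andP[ij j4] xyi xyj; have i4 : (i <= 4)%N by lia.
move/(mkfaceP S _ _ i4): xyi => wi; move/(mkfaceP S _ _ j4): xyj => wj.
have [k wk ka] : exists2 k, x^-1 * y \in H k &
    forall a : 'I_3, a.+1 != k -> (i < a.+1 < j)%N.
  have [i0|i0] := posnP i.
    by exists j => // a; have := ltn_ord a; lia.
  by exists i => // a; have := ltn_ord a; lia.
move: wk; apply: (fintype.subsetP _); rewrite gen_subG; apply/fintype.subsetP => _ /imsetP[a + ->].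
by rewrite inE => /ka aij; apply/mem_gen/imset_f; rewrite inE.
Qed.

(** Multiplication of a flag by a generator changes only one of its faces, and in
    a section of rank at least 2 there is another one, incident to both. So the
    proper faces of the section can be reached by following a word in the
    generators of the stabilizer of its bounds. *)
Lemma coset_section_connected (F G : coset_face S) : (F <= G)%O -> section_connected F G.
Proof.
move=> FG; have [z [zF zG]] := fm_pair fm FG.
set i := frank F in zF; set j := frank G in zG.
have ij : (i <= j)%N by move/fleP: FG => [].
have j4 : (j <= 4)%N := frank_le4 G.
have [ji|ji] := leqP j i.+2.
  left; exists (model_flag (face := mk) z); split.
  - exact: (model_flagP fm).
  - by exists i => //=; rewrite ltnS; lia.
  - by exists j.
  - have := card_set1 (x := mk z i.+1); rewrite card_eq_le => /andP[c1 _].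
    apply: card_le_trans c1; apply: subset_card_le.
    move=> _ [[k k5 <-]]; rewrite /proper_faces /= -zF -zG => /andP[].
    rewrite !(face_lt_rk fm)//; try lia.
    by move=> ik kj; congr (mk z _); lia.
right=> K L.
have common M : proper_faces F G M -> exists x, [/\ mk x i = F, mk x j = G & mk x (frank M) = M /\ (i < frank M < j)%N].
  move=> /andP[FM MG]; have [x [xF xM xG]] := fle_common (ltW FM) (ltW MG).
  by exists x; split=> //; split=> //; rewrite (fm_lt fm FM) (fm_lt fm MG).
move=> /common[x [xF xG [xK iKj]]] /common[y [yF yG [yL iLj]]].
pose conn M := exists s : seq (coset_face S), [/\ {in s, forall N, proper_faces F G N},
     path (fun x y => x >=< y)%O K s & last K s = M].
have connS M N : conn M -> (M >=< N)%O -> proper_faces F G N -> conn N.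
  move=> [s [sP sp sl]] MN FGN; exists (rcons s N); split.
  - by move=> N'; rewrite mem_rcons inE => /predU1P[->//|/sP].
  - by rewrite rcons_path sp sl.
  - by rewrite last_rcons.
have conn0 : conn K by exists [::].
have prop u k : mk u i = F -> mk u j = G -> (i < k < j)%N -> proper_faces F G (mk u k).
  by move=> <- <- ikj; apply: proper_mk.
have xy : x^-1 * y \in <<[set S a | a : 'I_3 & i < a.+1 < j]%SET>>.
  by apply: parabolic_section; rewrite ?xF ?xG ?yF ?yG ?ji.
suff [_ _ C] : [/\ mk (x * (x^-1 * y)) i = F, mk (x * (x^-1 * y)) j = G & conn (mk (x * (x^-1 * y)) i.+1)].
  rewrite mulKVg in C; rewrite -yL; apply: connS C _ _; first by apply: mk_comp; lia.
  exact: prop.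
move: (x^-1 * y) xy; apply: gen_ind => [|w a [wF wG C] /imsetP[b + ->]].
  rewrite mulg1; split=> //; apply: connS conn0 _ _; last by apply: prop => //; lia.
  by rewrite -xK; apply: mk_comp; lia.
rewrite inE => ibj; rewrite mulgA; set u := x * w in wF wG C *.
have ub k : (k <= 4)%N -> k != b.+1 -> mk (u * S b) k = mk u k.
  by move=> k4 kb; rewrite -rmulE; apply: (adj_other fm).
have uF : mk (u * S b) i = F by rewrite ub//; lia.
have uG : mk (u * S b) j = G by rewrite ub//; lia.
split=> //; have [bi|bi] := eqVneq (b : nat) i; last by rewrite ub //; lia.
have C2 : conn (mk (u * S b) i.+2).
  rewrite ub; [|lia|lia]; apply: connS C _ _; last by apply: prop => //; lia.
  by apply: mk_comp; lia.
apply: connS C2 _ _; last by apply: prop => //; lia.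
by apply: mk_comp; lia.
Qed.

Lemma coset_polyhedron : polyhedron (coset_face S).
Proof.
split; [exact: (flagP2 fm)|exact: coset_section_connected|exact: (edge_diamonds fm)|].
exact: (vertex_face_diamond fm).
Qed.

(** Independent of the chosen representative of the coset, by [left_mulE]. *)
Definition left_mul (g : gT) (F : coset_face S) : coset_face S :=
  mk (g * xchoose (existsP (valP F))) (frank F).

Lemma left_mulE g x i : (i <= 4)%N -> left_mul g (mk x i) = mk (g * x) i.
Proof.
move=> i4; rewrite /left_mul frank_mk//; apply/mkfaceP => //.
set y := xchoose _; have /eqP /= := xchooseP (existsP (valP (mk x i))).
rewrite -/y inordK// => /lcoset_eqP; rewrite mem_lcoset => xy.
by rewrite invMg mulgA mulgKV.
Qed.

Lemma left_mulM g h F : left_mul g (left_mul h F) = left_mul (g * h) F.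
Proof.
have [x ->] := mkface_frank F; have F4 := frank_le4 F.
by rewrite !left_mulE// mulgA.
Qed.

Lemma left_mul1 F : left_mul 1 F = F.
Proof. by have [x ->] := mkface_frank F; rewrite left_mulE ?frank_le4// mul1g. Qed.

Lemma left_mul_le g F G : (F <= G)%O -> (left_mul g F <= left_mul g G)%O.
Proof.
move=> FG; have [x [xF xG]] := fm_pair fm FG.
have /fleP[FG' _] := FG.
by rewrite -xF -xG !left_mulE ?frank_le4// mk_le// FG' frank_le4.
Qed.

Lemma left_mul_bij g : `[< bijective (left_mul g) >].
Proof.
by apply/asboolP; exists (left_mul g^-1) => F; rewrite left_mulM ?mulVg ?mulgV left_mul1.
Qed.

Definition left_sym g : sym (coset_face S) := Defs.Sym (left_mul_bij g).

Lemma left_sym_auto g : automorphisms (left_sym g).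
Proof.
move=> F G /=; apply/idP/idP; last exact: left_mul_le.
by move/(left_mul_le g^-1); rewrite !left_mulM mulVg !left_mul1.
Qed.

Lemma left_sym_flag g x :
  left_sym g @` val (flag_of fm x) = val (flag_of fm (g * x)).
Proof.
rewrite eqEsubset; split=> [_ [_ [i i5 <-] <-]|_ [i i5 <-]] /=.
  by exists i => //; rewrite left_mulE.
by exists (mk x i); [exists i|rewrite left_mulE].
Qed.

Lemma coset_regular : regular (coset_face S).
Proof.
move=> Phi Psi; have [x ->] := flag_of_surj fm Phi; have [y ->] := flag_of_surj fm Psi.
exists (left_sym (y * x^-1)); first exact: left_sym_auto.
by rewrite left_sym_flag mulgKV.
Qed.

Lemma left_sym_distinguished i : is_distinguished_generator (flag_of fm 1) i (left_sym (S i)).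
Proof.
split; first exact: left_sym_auto.
exists (flag_of fm (S i)); last by rewrite left_sym_flag mulg1.
by apply/i_adjacent_flag_of; rewrite rmulE mul1g.
Qed.

(** An automorphism commutes with the adjacency of flags, which is the right
    multiplication by the generators. *)
Lemma automorphism_flag (s : sym (coset_face S)) : automorphisms s ->
  exists g, forall x, s @` val (flag_of fm x) = val (flag_of fm (g * x)).
Proof.
move=> sA; have [t sK tK] := sym_bij s; have fm' := flag_model_iso fm sK tK sA.
have sE x : s @` val (flag_of fm x) = val (flag_of fm' x) by rewrite /= image_comp.
pose sigma x := flag_index fm (flag_of fm' x).
have sigmaK x : flag_of fm (sigma x) = flag_of fm' x by exact: flag_indexK.
have sigmaS x i : sigma (x * S i) = sigma x * S i.
  rewrite -(rmulE S i (sigma x)); apply/(i_adjacent_flag_of fm); rewrite !sigmaK.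
  by apply/(i_adjacent_flag_of fm'); rewrite rmulE.
exists (sigma 1) => x; rewrite sE -sigmaK; congr (val (flag_of fm _)).
have : x \in <<[set S i | i : 'I_3]%SET>> by rewrite (sgen_gen S) inE.
move: x; apply: gen_ind => [|x _ IH /imsetP[i _ ->]]; first by rewrite mulg1.
by rewrite sigmaS IH mulgA.
Qed.

End CosetPolyhedron.

(** * Covers by a coset poset *)

Section Covers.
Local Open Scope group_scope.
Context {d : Order.disp_t} {Q : tbPOrderType d} {X : finType}.
Context {r : 'I_3 -> {perm X}} {rk : Q -> nat} {face : X -> nat -> Q}.
Hypothesis fmQ : flag_model (fun i => r i) rk face.
Variables (gT : finGroupType) (S : string_C_group gT).
Let R : tbPOrderType _ := coset_face S.
Let fm := coset_flag_model S.

(** An automorphism of the coset poset acts on its flags, which are the elements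
    of the group, as the left multiplication by some g. Permutations act on the
    right, so it is the inverse of g that depends multiplicatively on the
    automorphism. *)
Lemma coset_covers (phi : gT -> {perm X}) :
  {morph phi : x y / x * y} -> (forall x, phi x \in flag_group (r := r)) ->
  (forall i, phi (S i) = r i) -> covers R Q.
Proof.
move=> phiM phiG phir.
pose act (s : sym R) g := forall x, s @` val (flag_of fm x) = val (flag_of fm (g * x)).
have act_uniq s g g' : act s g -> act s g' -> g = g'.
  move=> sg sg'; have := sg 1; rewrite sg' !mulg1 => /val_inj.
  by move/(flag_of_inj (fm := fm)).
pose ind (s : sym R) : gT := xget 1 [set g | act s g].
have indE s g : act s g -> ind s = g.
  by move=> sg; apply: (act_uniq s _ _ _ sg); apply: (@xgetPex _ 1 [set g | act s g]); exists g.
exists (flag_of fm 1), (fun i => left_sym S (S i)), (fun s => sym_of_perm fmQ (phi (ind s)^-1)).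
split.
- exact: left_sym_distinguished.
- by move=> s _; apply: monodromy_group_sym_of_perm.
- move=> s t /automorphism_flag[g sg] /automorphism_flag[g' tg'].
  have -> : ind (s * t) = g' * g.
    by apply: indE => x; rewrite -mulgA -tg' -sg; exact/esym/image_comp.
  by rewrite (indE _ _ sg) (indE _ _ tg') -sym_of_permM -phiM -invMg.
- move=> i; rewrite (mon_generatorE fmQ); congr sym_of_perm.
  rewrite (indE _ (S i)); last by move=> x; rewrite left_sym_flag.
  by rewrite -phir; congr phi; apply/eqP; rewrite eq_invg_mul sgen_inv.
Qed.

Definition rmulg (g : gT) : {perm gT} := perm (mulIg g).

Lemma rmulgM g h : rmulg (g * h) = rmulg g * rmulg h.
Proof. by apply/permP => x; rewrite permM !permE mulgA. Qed.

Lemma rmulg_in g : rmulg g \in flag_group (r := rmul S).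
Proof.
have : g \in <<[set S i | i : 'I_3]%SET>> by rewrite (sgen_gen S) inE.
move: g; apply: gen_ind => [|x _ xG /imsetP[i _ ->]].
  rewrite (_ : rmulg 1 = 1) ?group1//; apply/permP => x.
  by rewrite permE perm1 mulg1.
by rewrite rmulgM groupM// mem_gen//; apply/imsetP; exists i.
Qed.

Lemma rmulg_transitive x y :
  exists2 g, g \in flag_group (r := rmul S) & g x = y.
Proof. by exists (rmulg (x^-1 * y)); rewrite ?rmulg_in// permE mulKVg. Qed.

(** The monodromy group of the coset poset is the group itself acting by right
    multiplication, so a morphism to the monodromy group of Q can be followed by
    psi. *)
Lemma cover_factor (psi : {perm X} -> gT) {e} (A : tbPOrderType e) :
  {in flag_group (r := r) &, {morph psi : x y / x * y}} ->
  (forall i, psi (r i) = S i) -> covers A Q -> covers A R.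
Proof.
move=> psiM psir [Phi [rho [h [dist hmon hM hrho]]]].
exists Phi, rho, (fun s => sym_of_perm fm (rmulg (psi (perm_of_sym fmQ (h s))))).
split=> //.
- by move=> s _; apply: monodromy_group_sym_of_perm; exact: rmulg_in.
- move=> s t sA tA; rewrite hM// perm_of_symM psiM ?perm_of_monodromy//; try exact: hmon.
  by rewrite rmulgM sym_of_permM.
- move=> i; rewrite hrho (mon_generatorE fmQ) sym_of_permK psir (mon_generatorE fm).
  by congr sym_of_perm; apply/permP => x; rewrite !permE.
Qed.

Lemma card_rank k : (k <= 4)%N ->
  #|[pred F : coset_face S | frank F == k]| = #|[set: gT]%SET : parabolic S k|.
Proof.
move=> k4; rewrite -card_lcosets -(card_in_imset (f := fun F : coset_face S => (val F).2)).
  apply: eq_card => B; apply/imsetP/imsetP => [[F + ->]|[x _ ->]].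
    rewrite inE => /eqP Fk; have [x ->] := mkface_frank F; exists x => //=.
    by rewrite lcosetE Fk inordK.
  by exists (mkface S x k); rewrite ?inE ?frank_mk//= lcosetE inordK.
move=> F G; rewrite !inE => /eqP Fk /eqP Gk FG; apply: val_inj.
move: Fk Gk FG; rewrite /frank; case: (val F) (val G) => [i B] [j C] /= iE jE ->.
by congr pair; apply: val_inj; rewrite /= iE.
Qed.

End Covers.

Section Isomorphic.
Variables (gT : finGroupType) (S : string_C_group gT).
Context {e : Order.disp_t} {A : tbPOrderType e}.
Hypothesis RA : isomorphic (coset_face S) A.
Lemma isomorphic_model : exists (rkA : A -> nat) (faceA : gT -> nat -> A), flag_model (fun i => rmul S i) rkA faceA.
Proof.
have [f [g fK gK] mf] := RA.
by exists (@frank _ S \o g), (fun x i => f (mkface S x i)); apply: flag_model_iso mf => //; exact: coset_flag_model.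
Qed.

Lemma isomorphic_card k : (k < 3)%N ->
  (of_rank k : set A) #= `I_#|[set: gT]%SET : parabolic S k.+1|%g.
Proof.
move=> k3; have [f [g fK gK] mf] := RA.
have fm := flag_model_iso (coset_flag_model S) fK gK mf.
rewrite (of_rankE fm); last by lia.
rewrite -card_rank; last by lia.
rewrite -(card_eqr (card_finpred _)).
have -> : [set F | (frank (S:=S) \o g) F = k.+1] = f @` [set F | F \in [pred F : coset_face S | frank F == k.+1]].
  rewrite eqEsubset; split=> [F Fk|_ [F + <-]] /=.
    by exists (g F); rewrite ?gK//= inE; apply/eqP.
  by rewrite fK => /eqP.
by apply: inj_card_eq => x y _ _; exact: (can_inj fK).
Qed.
End Isomorphic.

(** * The flags of the antiprism *)

Section Cells.
Variable m : nat.
Hypothesis m_gt0 : (0 < m)%N.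
Local Notation q := (6 * m)%N.
Local Open Scope ring_scope.

Lemma q_gt1 : (1 < q)%N. Proof. by lia. Qed.

Lemma Zp_trunc_q : (Zp_trunc q).+2 = q. Proof. exact: Zp_cast q_gt1. Qed.

(** The vertex reached from j after c steps along the zigzag, backwards when e
    holds. *)
Definition step (j : 'Z_q) (e : bool) (c : nat) : 'Z_q := if e then j - c%:R else j + c%:R.

Lemma step0 j e : step j e 0 = j.
Proof. by rewrite /step; case: e; rewrite ?subr0 ?addr0. Qed.

Lemma stepD j e c c' : step (step j e c) e c' = step j e (c + c').
Proof. by rewrite /step; case: e; rewrite natrD ?opprD addrA. Qed.

Lemma stepB j e c c' : (c' <= c)%N -> step (step j e c) (~~ e) c' = step j e (c - c').
Proof.
move=> cc; rewrite /step; case: e => /=; rewrite natrB//; last by rewrite addrA.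
by rewrite opprB -addrA [- _ + _]addrC.
Qed.

Lemma stepB_rev j e c c' : (c <= c')%N -> step (step j e c) (~~ e) c' = step j (~~ e) (c' - c).
Proof.
move=> cc; rewrite /step; case: e => /=; rewrite natrB// ?opprB ?[_%:R - _]addrC ?addrA//.
by rewrite addrAC.
Qed.

Lemma natr_neq0 c : (0 < c < 6)%N -> (c%:R : 'Z_q) != 0.
Proof.
move=> c6; rewrite -val_eqE /= val_Zp_nat ?q_gt1// modn_small; lia.
Qed.

(** The vertices at distance at most 2 from j are distinct because the zigzag has
    at least 6 vertices. *)
Lemma step_eq j e e' c c' : (c <= 2)%N -> (c' <= 2)%N ->
  (step j e c == step j e' c') = (c == c') && ((c == 0)%N || (e == e')).
Proof.
move=> c2 c2'.
have same (a b : nat) : (a <= 2)%N -> (b <= 2)%N -> ((a%:R : 'Z_q) == b%:R) = (a == b).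
  wlog ab : a b / (a <= b)%N.
    by move=> W a2 b2; have [/W->//|/ltnW/W h] := leqP a b; rewrite eq_sym h// eq_sym.
  move=> a2 b2; rewrite eq_sym -subr_eq0 -natrB//.
  have [->|nab] := eqVneq a b; first by rewrite subnn eqxx.
  by apply/negbTE/natr_neq0; lia.
have opp (a b : nat) : (a <= 2)%N -> (b <= 2)%N -> ((- a%:R : 'Z_q) == b%:R) = (a == b) && (a == 0)%N.
  move=> a2 b2; rewrite eq_sym -addr_eq0 -natrD.
  have [->|a0] := posnP a; first by rewrite addn0 andbT (same _ 0%N)// eq_sym.
  by rewrite andbF; apply/negbTE/natr_neq0; lia.
rewrite /step; case: e e' => -[]; rewrite (inj_eq (addrI _)) ?(inj_eq oppr_inj).
- by rewrite same// eqxx orbT andbT.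
- by rewrite opp// orbF.
- by rewrite eq_sym opp// orbF eq_sym; case: eqP => //= ->.
- by rewrite same// eqxx orbT andbT.
Qed.

Definition parity (j : 'Z_q) : bool := odd j.

Lemma odd_modq n : odd (n %% (Zp_trunc q).+2) = odd n.
Proof.
rewrite Zp_trunc_q {2}(divn_eq n q) oddD oddM mulnC.
by rewrite [odd (m * 6)]oddM /= andbF andbF.
Qed.

Lemma parityD j k : parity (j + k) = parity j (+) parity k.
Proof. by rewrite /parity /= odd_modq oddD. Qed.

Lemma parity_nat c : parity c%:R = odd c.
Proof. by rewrite /parity val_Zp_nat ?q_gt1// -[X in (_ %% X)%N]Zp_trunc_q odd_modq. Qed.

Lemma parityN j : parity (- j) = parity j.
Proof.
have := parityD j (- j); have p0 : parity 0 = false by exact: (parity_nat 0).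
by rewrite addrN p0; case: (parity j) (parity (- j)) => -[].
Qed.

Lemma parity_step j e c : parity (step j e c) = parity j (+) odd c.
Proof. by rewrite /step; case: e; rewrite parityD ?parityN parity_nat. Qed.

(** A flag is (j, e, s, f): its vertex is j; its edge goes from j in the
    direction e, to the next vertex when s holds (an edge between the two
    n-gons) and to the one after it otherwise (an edge of an n-gon). Three
    triangles and one n-gon meet at j. When f holds, the face is the triangle
    that starts at j in the direction e; otherwise it is the triangle with j in
    the middle when s holds, and the n-gon when it does not. *)
Definition zflag := ('Z_q * bool * bool * bool)%type.

Definition adj (i : 'I_3) (x : zflag) : zflag :=
  let: (j, e, s, f) := x in
  match val i with
  | 0 => if s then (step j e 1, ~~ e, s, ~~ f) else (step j e 2, ~~ e, s, f)
  | 1 => if f then (j, e, ~~ s, f) else (j, ~~ e, s, f)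
  | _ => (j, e, s, ~~ f)
  end.

Lemma adjK i : involutive (adj i).
Proof.
move: i; apply: ord3_case => -[[[j e] s] f]; rewrite /adj /=;
  case: s; case: f => //=; rewrite ?negbK// stepB ?step0 //.
Qed.

Definition edge (j : 'Z_q) e (s : bool) : {set 'Z_q} :=
  [set j; step j e (if s then 1 else 2)]%SET.

Definition polygon (j : 'Z_q) e (s f : bool) : {set 'Z_q} :=
  if f then [set j; step j e 1; step j e 2]%SET
  else if s then [set step j (~~ e) 1; j; step j e 1]%SET
  else [set k | parity k == parity j]%SET.

Definition cell (x : zflag) (i : nat) : {set 'Z_q} :=
  let: (j, e, s, f) := x in
  match i with
  | 0 => finset.set0
  | 1 => [set j]%SET
  | 2 => edge j e s
  | 3 => polygon j e s f
  | _ => [set: 'Z_q]%SET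
  end.

Lemma cell_adj (i : 'I_3) k x : k != i.+1 -> cell (adj i x) k = cell x k.
Proof.
case: x => -[[j e] s] f; move: i; apply: ord3_case => /=;
  case: k => [|[|[|[|k]]]] //=; case: s; case: f => // _;
  rewrite /= /edge /polygon /=; apply/setP => z; rewrite !inE ?negbK ?parity_step ?addbF//;
  rewrite ?stepD ?(@stepB_rev _ _ 1 2)// ?stepB// ?subSS ?subnn ?subn0 ?step0;
  by case_eqs z.
Qed.

(** The neighbours of j determine the cells of a flag with vertex j; this lemma
    and the next one tell which of the vertices at distance 1 or 2 from j belong
    to the edge and to the face. *)
Lemma mem_edge j e s e' c : (0 < c <= 2)%N ->
  (step j e' c \in edge j e s) = (c == if s then 1 else 2)%N && (e' == e).
Proof.
move=> /andP[c0 c2]; rewrite !inE -{2}(step0 j e) !step_eq//; last by case: s.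
by rewrite (gtn_eqF c0).
Qed.

Lemma mem_polygon j e s f e' c : (0 < c <= 2)%N ->
  (step j e' c \in polygon j e s f) =
  if f then e' == e else if s then c == 1%N else c == 2%N.
Proof.
move=> /andP[c0 c2]; rewrite /polygon; case: f; last case: s; rewrite !inE.
- rewrite -{2}(step0 j e) !step_eq// (gtn_eqF c0) /=.
  by case: (e' == e); rewrite ?andbF// !andbT; lia.
- rewrite -{4}(step0 j e) !step_eq// (gtn_eqF c0) /=.
  by case: (c == 1%N); case: e; case: e'.
- by rewrite parity_step; case: (parity j) => /=; lia.
Qed.

Lemma edge_inj j e s e' s' : edge j e s = edge j e' s' -> e = e' /\ s = s'.
Proof.
move=> E; have := mem_edge j e s e (c := if s then 1 else 2).
rewrite E mem_edge; last by case: s {E}.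
by case: s {E} => /(_ isT); rewrite eqxx /=; case: s' => //= /eqP ->.
Qed.

Lemma polygon_eq j e s f e' s' f' : polygon j e s f = polygon j e' s' f' ->
  f = f' /\ if f then e = e' else s = s'.
Proof.
move=> E; have M e0 c : (0 < c <= 2)%N ->
    (if f then e0 == e else if s then c == 1%N else c == 2%N) =
    (if f' then e0 == e' else if s' then c == 1%N else c == 2%N).
  by move=> c2; rewrite -(mem_polygon j e s f)// E mem_polygon.
move: (M true 1 isT) (M true 2 isT) (M false 1 isT) (M false 2 isT) => {M E}.
by case: e s f e' s' f' => -[] [] [] [] [].
Qed.

Lemma cell_inj x y : (forall i : 'I_3, cell x i.+1 = cell y i.+1) -> x = y.
Proof.
case: x => -[[j e] s] f; case: y => -[[j' e'] s'] f' E.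
have /set1_inj jj' := E o0.
have := E o2; have := E o1.
by rewrite /= -{}jj' => /edge_inj[-> ->] /polygon_eq[->].
Qed.

Lemma cell_adj_neq (i : 'I_3) x : cell (adj i x) i.+1 <> cell x i.+1.
Proof.
case: x => -[[j e] s] f; move: i; apply: ord3_case => /=.
- case: s => /= /set1_inj/eqP; by rewrite -{2}(step0 j e) step_eq.
- by case: f => /= /edge_inj[]; case: s; case: e.
- by move/polygon_eq => []; case: f.
Qed.

Lemma cell_diamond (i : 'I_3) x y :
  (forall k : 'I_3, k != i -> cell y k.+1 = cell x k.+1) -> y = x \/ y = adj i x.
Proof.
case: x => -[[j e] s] f; case: y => -[[j' e'] s'] f'; move: i; apply: ord3_case => E.
- have yz z : cell (j', e', s', f') 1 = cell z 1 ->
      (forall k : 'I_3, k != @Ordinal 3 0 isT -> cell z k.+1 = cell (j, e, s, f) k.+1) ->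
      (j', e', s', f') = z.
    move=> z1 zk; apply: cell_inj; apply: ord3_case; first exact: z1.
      by rewrite E// zk.
    by rewrite E// zk.
  have := finset.set21 j' (step j' e' (if s' then 1 else 2)).
  have /= := E o1 isT; rewrite -/(edge j' e' s') => ->.
  rewrite !inE => /orP[] /eqP jj'; [left|right].
  + by apply: yz; rewrite //= jj'.
  + apply: (yz (adj o0 (j, e, s, f))).
      by rewrite jj' /adj /=; case: (s).
    by move=> k k0; rewrite cell_adj// eqSS eq_sym.
- have /set1_inj jj := E o0 isT; rewrite jj in E *.
  have := E o2 isT; move=> /= /polygon_eq {E}.
  by case: e s f e' s' f' => -[] [] [] [] [] //= []; auto.
- have /set1_inj jj := E o0 isT; rewrite jj in E *.
  have := E o1 isT; move=> /= /edge_inj {E} [-> ->].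
  by rewrite /adj /=; case: f f' => -[]; auto.
Qed.

Lemma card_edge j e s : #|edge j e s| = 2.
Proof. by rewrite cards2 -{1}(step0 j e) step_eq//; case: s. Qed.

Lemma card_polygon_ge3 j e s f : (3 <= #|polygon j e s f|)%N.
Proof.
have [a [b [c [ab ac bc]]]] : exists a b c, [/\ (a != b) && (a \in polygon j e s f),
   (a != c) && (b \in polygon j e s f) & (b != c) && (c \in polygon j e s f)].
  rewrite /polygon; case: f; last case: s.
  - exists (step j e 0), (step j e 1), (step j e 2).
    by rewrite !step_eq// !inE step0 !eqxx ?orbT.
  - exists (step j e 0), (step j e 1), (step j (~~ e) 1).
    by rewrite !step_eq// !inE step0 !eqxx ?orbT; case: (e).
  - exists (step j e 0), (step j e 2), (step j (~~ e) 2).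
    by rewrite !step_eq// !inE !parity_step !addbF !eqxx; case: (e).
apply/card_geqP; exists [:: a; b; c]; move: ab ac bc => /andP[ab aP] /andP[ac bP] /andP[bc cP].
split=> //; first by rewrite /= !inE negb_or ab ac bc.
by move=> z; rewrite !inE => /or3P[] /eqP ->.
Qed.

Lemma card_polygon_le3 j e s f : f || s -> (#|polygon j e s f| <= 3)%N.
Proof.
rewrite /polygon; case: f => [_|/= ->]; rewrite finset.setUC cardsU1 cards2;
  by apply: (@leq_add _ _ 1 2); rewrite ?ltnS leq_b1.
Qed.

Lemma polygon_neqT j e s f : polygon j e s f != [set: 'Z_q]%SET.
Proof.
have out e' c : (0 < c <= 2)%N -> ~~ (if f then e' == e else if s then c == 1%N else c == 2%N) ->
    polygon j e s f != [set: 'Z_q]%SET.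
  by move=> c2; rewrite -(mem_polygon j)//; apply: contraNN => /eqP ->; rewrite inE.
case: f out => out; first by apply: (out (~~ e) 1%N) => //; case: (e).
by case: s out => out; [apply: (out e 2%N)|apply: (out e 1%N)].
Qed.

Lemma card_Zq : #|{: 'Z_q}| = q.
Proof. by rewrite card_ord Zp_trunc_q. Qed.

(** Edges have two vertices and faces at least three, which must be told apart
    from the greatest face. *)
Definition crank (K : {set 'Z_q}) : nat := if K == [set: 'Z_q]%SET then 4 else minn #|K| 3.

Lemma crank_small (K : {set 'Z_q}) : (#|K| <= 2)%N -> crank K = #|K|.
Proof.
rewrite /crank; case: eqP => [->|_]; last by lia.
by rewrite cardsT card_Zq; lia.
Qed.

Lemma crank_cell x i : (i <= 4)%N -> crank (cell x i) = i.
Proof.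
case: x => -[[j e] s] f; case: i => [|[|[|[|[|//]]]]] _ /=.
- by rewrite crank_small cards0.
- by rewrite crank_small cards1.
- by rewrite crank_small card_edge.
- by rewrite /crank (negPf (polygon_neqT _ _ _ _)) (minn_idPr (card_polygon_ge3 _ _ _ _)).
- by rewrite /crank eqxx.
Qed.

Lemma polygon_self j e s f : j \in polygon j e s f.
Proof. by rewrite /polygon; case: f; last case: s; rewrite !inE eqxx ?orbT. Qed.

(** A triangle has the least number of vertices among the faces, and it contains
    vertices of both parities, unlike the n-gons. *)
Lemma polygon_sub j e s f j' e' s' f' :
  polygon j e s f \subset polygon j' e' s' f' -> polygon j e s f = polygon j' e' s' f'.
Proof.
move=> KL; have [fs|] := boolP (f' || s').
  by apply/eqP; rewrite eqEcard KL (leq_trans (card_polygon_le3 _ _ fs))// card_polygon_ge3.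
rewrite negb_or => /andP[/negPf f0 /negPf s0]; subst f' s'.
have jL : step j e 0 \in polygon j' e' false false.
  by apply: (fintype.subsetP KL); rewrite step0 polygon_self.
have eL : (f || s) -> step j e 1 \in polygon j' e' false false.
  move=> fs; apply: (fintype.subsetP KL); rewrite mem_polygon//.
  by move: fs; case: (f) => //= ->.
have := eL; move: jL; rewrite /polygon /= !inE !parity_step /= addbF => /eqP ->.
rewrite addbT => h; have : ~~ (f || s) by apply/negP => /h; case: (parity j').
by rewrite negb_or => /andP[/negPf -> /negPf ->].
Qed.

(** Cells are ordered by their numbers of vertices, except that a face may have
    more vertices than another one. *)
Lemma crank_lt x y i j : (i <= 4)%N -> (j <= 4)%N ->
  cell x i \proper cell y j -> (i < j)%N.
Proof.
move=> i4 j4 xy; have := proper_card xy.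
have ri := crank_cell x i4; have rj := crank_cell y j4.
have KT : cell x i != [set: 'Z_q]%SET.
  by move: xy; rewrite properE => /andP[_]; apply: contraNneq => ->; rewrite finset.subsetT.
move: ri rj; rewrite /crank (negPf KT); case: eqP => [_|/eqP LT] ri rj; first by lia.
move=> lt; suff: ~~ (3 <= #|cell x i|)%N by lia.
apply/negP => K3; have i3 : i = 3%N by lia.
have j3 : j = 3%N by lia.
subst i j; case: x y xy {lt ri rj KT LT K3} => [[[j e] s] f] [[[j' e'] s'] f'] /= xy.
by move: (xy); rewrite (polygon_sub (proper_sub xy)) fintype.properxx.
Qed.

(** A triangle with its vertex in the middle starts one step backwards. *)
Lemma polygon_tri j e s f : f || s -> exists k e', forall s', polygon j e s f = polygon k e' s' true.
Proof.
case: f => [_|/= ->]; first by exists j, e.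
exists (step j (~~ e) 1), e => _; rewrite /polygon -{5 7}[e]negbK.
by rewrite stepB// (@stepB_rev _ _ 1)// !subSS subn0 step0 negbK.
Qed.

Lemma polygon_gon j e e' k : k \in polygon j e false false ->
  polygon k e' false false = polygon j e false false.
Proof. by rewrite /polygon inE => /eqP ->. Qed.

(** Here z is y or its 0-adjacent flag. *)
Lemma vertex_edge_pair j y : j \in cell y 2 ->
  exists z, [/\ cell z 1 = [set j]%SET, cell z 2 = cell y 2 & cell z 3 = cell y 3].
Proof.
case: y => -[[j' e'] s'] f' /=; rewrite !inE => /orP[] /eqP ->.
  by exists (j', e', s', f').
exists (adj o0 (j', e', s', f')); split; [|exact: cell_adj|exact: cell_adj].
by rewrite /adj /=; case: s'.
Qed.

Lemma vertex_polygon_pair k y : k \in cell y 3 ->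
  exists z, cell z 1 = [set k]%SET /\ cell z 3 = cell y 3.
Proof.
case: y => -[[j e] s] f /=; have [fs|] := boolP (f || s).
  have [l [e' E]] := polygon_tri j e fs.
  rewrite (E true) /polygon !inE -orbA => /or3P[] /eqP ->.
  - by exists (l, e', true, true).
  - exists (step l e' 1, e', true, false); split=> //=.
    by rewrite /polygon stepB// stepD subnn step0.
  - exists (step l e' 2, ~~ e', true, true); split=> //=.
    rewrite /polygon !stepB// subnn subSS subn0 step0.
    by apply/setP => z; rewrite !inE; case_eqs z.
rewrite negb_or => /andP[/negPf -> /negPf ->] kP.
by exists (k, e, false, false); split=> //; exact: polygon_gon.
Qed.

Lemma edge_polygon_pair x y : cell x 2 \subset cell y 3 ->
  exists z, cell z 2 = cell x 2 /\ cell z 3 = cell y 3.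
Proof.
case: x => -[[i a] t] g; case: y => -[[j e] s] f /=.
have [fs|] := boolP (f || s).
  have [l [e' E]] := polygon_tri j e fs.
  rewrite (E true) finset.subUset !finset.sub1set /polygon.
  have : i != step i a (if t then 1 else 2) by rewrite -{1}(step0 i a) step_eq//; case: (t).
  rewrite /edge; move: (step i a _) => b; rewrite !inE -!orbA => ib /andP[] /or3P[] /eqP iE /or3P[] /eqP bE;
    move: ib; rewrite iE bE ?eqxx// => _.
  - by exists (l, e', true, true).
  - by exists (l, e', false, true).
  - by exists (l, e', true, true); split=> //=; rewrite /edge finset.setUC.
  - exists (step l e' 2, ~~ e', true, true); rewrite /= /edge /polygon !stepB// subnn subSS subn0 step0.
    by split; apply/setP => z; rewrite !inE; case_eqs z.
  - by exists (l, e', false, true); split=> //=; rewrite /edge finset.setUC.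
  - exists (step l e' 2, ~~ e', true, true); rewrite /= /edge /polygon !stepB// subnn subSS subn0 step0.
    by split; apply/setP => z; rewrite !inE; case_eqs z.
rewrite negb_or => /andP[/negPf -> /negPf ->]; rewrite finset.subUset !finset.sub1set => /andP[iP].
rewrite inE parity_step; move: (iP); rewrite inE => /eqP ->; case: t => /=.
  by rewrite addbT; case: (parity j).
by exists (i, a, false, false); split=> //; exact: (@polygon_gon j e).
Qed.

Lemma cell_pair x y i j : (i < j <= 4)%N -> cell x i \subset cell y j ->
  exists z, cell z i = cell x i /\ cell z j = cell y j.
Proof.
case: i => [|i] ij.
  by exists y; split=> //; case: (x) (y) => -[[? ?] ?] ? [[[? ?] ?] ?].
have [j4|j4] : j = 4%N \/ (j <= 3)%N by lia.
  by exists x; rewrite j4; split=> //; case: (x) (y) => -[[? ?] ?] ? [[[? ?] ?] ?].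
have [[-> ->]|[[-> ->]|[-> ->]]] :
    (i = 0 /\ j = 2 \/ i = 0 /\ j = 3 \/ i = 1 /\ j = 3)%N by lia.
- case: x => -[[k e] s] f; rewrite finset.sub1set => ky.
  by have [z [z1 z2 _]] := vertex_edge_pair ky; exists z.
- by case: x => -[[k e] s] f; rewrite finset.sub1set; exact: vertex_polygon_pair.
- exact: edge_polygon_pair.
Qed.

Lemma cell_mono x i j : (i < j <= 4)%N -> cell x i \proper cell x j.
Proof.
move=> ij; have sub : cell x i \subset cell x j.
  case: x => -[[k e] s] f.
  have e3 : edge k e s \subset polygon k e s f.
    rewrite finset.subUset !finset.sub1set polygon_self mem_polygon; last by case: (s).
    by rewrite eqxx; case: (f) (s) => -[].
  case: i j ij => [|[|[|[|i]]]] [|[|[|[|[|j]]]]] //= _; rewrite ?finset.sub0set ?finset.subsetT//.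
  + by rewrite finset.sub1set !inE eqxx.
  + by apply: fintype.subset_trans e3; rewrite finset.sub1set !inE eqxx.
rewrite finset.properEneq sub andbT; apply/eqP => /(congr1 crank).
by rewrite !crank_cell; lia.
Qed.

End Cells.

Section AntiprismModel.
Import Order.DefaultSetSubsetOrder.
Variable m : nat.
Hypothesis m_gt0 : (0 < m)%N.
Local Notation q := (6 * m)%N.
Local Notation n := (3 * m)%N.
Local Notation cell := (@cell m).
Local Open Scope ring_scope.

Lemma half_lt (k : 'Z_q) : (k./2 < n)%N.
Proof. have := ltn_ord k; rewrite {2}(Zp_trunc_q m_gt0); lia. Qed.

(** The vertices v_i and u_i, that is, inr i and inl i, are at the places 2i and
    2i + 1 of the zigzag. *)
Definition vert (k : 'Z_q) : 'I_n + 'I_n :=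
  if odd k then inl (Ordinal (half_lt k)) else inr (Ordinal (half_lt k)).

Lemma vert_inj : injective vert.
Proof.
move=> k l; rewrite /vert => kl; apply: val_inj => /=.
rewrite -(odd_double_half k) -(odd_double_half l).
by move: kl; case: (odd k); case: (odd l) => // -[->].
Qed.

Lemma vert_inl (i : 'I_n) : vert (i.*2.+1)%:R = inl i.
Proof.
have vE : nat_of_ord ((i.*2.+1)%:R : 'Z_q) = i.*2.+1.
  rewrite val_Zp_nat ?(q_gt1 m_gt0)// modn_small//; have := ltn_ord i; lia.
rewrite /vert; have -> /= : odd (i.*2.+1%:R : 'Z_q) = true by rewrite vE /= odd_double.
by congr inl; apply: val_inj; rewrite /= vE /= uphalf_double.
Qed.

Lemma vert_inr (i : 'I_n) : vert (i.*2)%:R = inr i.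
Proof.
have vE : nat_of_ord ((i.*2)%:R : 'Z_q) = i.*2.
  rewrite val_Zp_nat ?(q_gt1 m_gt0)// modn_small//; have := ltn_ord i; lia.
rewrite /vert; have -> /= : odd (i.*2%:R : 'Z_q) = false by rewrite vE /= odd_double.
by congr inr; apply: val_inj; rewrite /= vE /= doubleK.
Qed.

Lemma double_ordS (i : 'I_n) : ((ordS i).*2%:R : 'Z_q) = i.*2%:R + 2.
Proof.
rewrite -natrD /=; have := ltn_ord i; rewrite leq_eqVlt => /predU1P[E|iS].
  rewrite E modnn /=.
  have -> : (i.*2 + 2 = q)%N by lia.
  by rewrite pchar_Zp// q_gt1.
by rewrite modn_small// doubleS addn2.
Qed.

Lemma vert_even (i : 'I_n) (k : 'Z_q) : vert k = inr i ->
  [/\ vert (step k false 1) = inl i, vert (step k false 2) = inr (ordS i) & parity k = false].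
Proof.
rewrite -vert_inr => /vert_inj ->; rewrite /step; split.
- by rewrite -vert_inl -[(i.*2.+1)%:R]natr1.
- by rewrite -double_ordS vert_inr.
- by rewrite (parity_nat m_gt0) odd_double.
Qed.

Lemma vert_odd (i : 'I_n) (k : 'Z_q) : vert k = inl i ->
  [/\ vert (step k false 1) = inr (ordS i), vert (step k false 2) = inl (ordS i) & parity k = true].
Proof.
rewrite -vert_inl => /vert_inj ->; rewrite /step; split.
- by rewrite -vert_inr double_ordS -[(i.*2.+1)%:R]natr1 -addrA.
- by rewrite -vert_inl -[(i.*2.+1)%:R]natr1 -[((ordS i).*2.+1)%:R]natr1 double_ordS addrAC.
- by rewrite (parity_nat m_gt0) /= odd_double.
Qed.

Lemma vert_surj v : exists k, v = vert k.
Proof. by case: v => i; [exists (i.*2.+1)%:R; rewrite vert_inl|exists (i.*2)%:R; rewrite vert_inr]. Qed.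

Lemma imset2 (a b : 'Z_q) : vert @: [set a; b]%SET = [set vert a; vert b]%SET.
Proof. by rewrite imsetU1 imset_set1. Qed.

Lemma imset3 (a b c : 'Z_q) : vert @: [set a; b; c]%SET = [set vert a; vert b; vert c]%SET.
Proof. by rewrite imsetU imset2 imset_set1. Qed.

Lemma gon_image (b : bool) :
  vert @: [set k | parity k == b]%SET = [set (if b then inl i else inr i) | i : 'I_n]%SET.
Proof.
apply/setP => v; apply/imsetP/imsetP => [[k + ->]|[i _ ->]].
  rewrite inE => /eqP <-; case E: (vert k) => [i|i]; exists i => //.
    by have [_ _ ->] := vert_odd E.
  by have [_ _ ->] := vert_even E.
case: b; [exists (i.*2.+1)%:R|exists (i.*2)%:R]; rewrite ?vert_inl ?vert_inr//;
  by rewrite inE (parity_nat m_gt0) /= odd_double.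
Qed.

Lemma edge_flip (j : 'Z_q) e s :
  edge j e s = edge (step j e (if s then 1 else 2)) (~~ e) s.
Proof. by rewrite /edge stepB// subnn step0 finset.setUC. Qed.

Lemma tri_flip (j : 'Z_q) e s : polygon j e s true = polygon (step j e 2) (~~ e) s true.
Proof.
rewrite /polygon !stepB// subnn subSS subn0 step0.
by apply/setP => z; rewrite !inE; case_eqs z.
Qed.

Lemma edge_in (j : 'Z_q) e s : vert @: edge j e s \in antiprism_edges n.
Proof.
wlog -> : j e / e = false.
  by case: e => W; [rewrite edge_flip|]; apply: W.
rewrite imset2; case E: (vert j) => [i|i].
  have [V1 V2 _] := vert_odd E; case: s; rewrite ?V1 ?V2; apply/finset.setUP.
    by right; apply: imset_f.
  by do 2!(left; apply/finset.setUP); left; apply: imset_f.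
have [V1 V2 _] := vert_even E; case: s; rewrite ?V1 ?V2; apply/finset.setUP; left; apply/finset.setUP.
  by right; rewrite finset.setUC; apply: imset_f.
by left; apply/finset.setUP; right; apply: imset_f.
Qed.

Lemma polygon_in (j : 'Z_q) e s f : vert @: polygon j e s f \in antiprism_2faces n.
Proof.
have [fs|] := boolP (f || s); last first.
  rewrite negb_or => /andP[/negPf -> /negPf ->]; rewrite gon_image.
  apply/finset.setUP; left; apply/finset.setUP; left; rewrite finset.in_set2.
  by case: (parity j); rewrite eqxx ?orbT.
have [k [e' E]] := polygon_tri j e fs; rewrite (E true); move: k e' {E} => {fs}k {}e.
wlog -> : k e / e = false.
  by case: e => W; [rewrite tri_flip|]; apply: W.
rewrite /polygon imset3; case E: (vert k) => [i|i].
  have [-> -> _] := vert_odd E; apply/finset.setUP; left; apply/finset.setUP; right.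
  by apply/imsetP; exists i => //; apply/setP => z; rewrite !inE; case_eqs z.
have [-> -> _] := vert_even E; apply/finset.setUP; right.
by apply/imsetP; exists i => //; apply/setP => z; rewrite !inE; case_eqs z.
Qed.

Lemma cell_in x i : vert @: cell x i \in antiprism_faces n.
Proof.
case: x => -[[j e] s] f; case: i => [|[|[|[|i]]]]; apply/finset.setUP.
- by do 3!(left; apply/finset.setUP); left; rewrite /= imset0 !inE eqxx.
- by left; apply/finset.setUP; left; apply/finset.setUP; right; rewrite /= imset_set1 imset_f.
- by left; apply/finset.setUP; right; exact: edge_in.
- by right; exact: polygon_in.
- do 3!(left; apply/finset.setUP); right; rewrite /= finset.in_set1.
  by apply/eqP/setP => v; rewrite inE; have [k ->] := vert_surj v; rewrite imset_f.
Qed.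

Definition aface x i : antiprism n :=
  exist (fun A => A \in antiprism_faces n) _ (cell_in x i).

Lemma antiprism_face_cell A : A \in antiprism_faces n ->
  exists x i, (i <= 4)%N /\ A = vert @: cell x i.
Proof.
pose x0 : zflag m := (0, false, false, false).
have edgeE (j : 'Z_q) s : exists x i, (i <= 4)%N /\
    [set vert j; vert (step j false (if s then 1 else 2)%N)]%SET = vert @: cell x i.
  by exists (j, false, s, false), 2%N; rewrite /= -imset2.
have triE (j : 'Z_q) : exists x i, (i <= 4)%N /\
    [set vert j; vert (step j false 1); vert (step j false 2)]%SET = vert @: cell x i.
  by exists (j, false, true, true), 3%N; rewrite /= -imset3.
have gonE b : exists x i, (i <= 4)%N /\
    [set (if b then inl i else inr i) | i : 'I_n]%SET = vert @: cell x i.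
  have parityb : parity (if b then 1 else 0 : 'Z_q) = b.
    by case: b; rewrite ?(parity_nat m_gt0 1) ?(parity_nat m_gt0 0).
  by exists (if b then 1 else 0, false, false, false), 3%N; rewrite /= parityb gon_image.
have U i : exists2 k : 'Z_q, vert k = inl i & [/\ vert (step k false 1) = inr (ordS i),
    vert (step k false 2) = inl (ordS i) & parity k = true].
  by exists (i.*2.+1)%:R; rewrite ?vert_inl//; apply/vert_odd/vert_inl.
have V i : exists2 k : 'Z_q, vert k = inr i & [/\ vert (step k false 1) = inl i,
    vert (step k false 2) = inr (ordS i) & parity k = false].
  by exists (i.*2)%:R; rewrite ?vert_inr//; apply/vert_even/vert_inr.
case/finset.setUP => [/finset.setUP[/finset.setUP[/finset.set2P[->|->]|/imsetP[v _ ->]]|]|].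
- by exists x0, 0%N; rewrite /= imset0.
- exists x0, 4%N; split=> //=; apply/setP => v; rewrite inE.
  by have [k ->] := vert_surj v; rewrite imset_f.
- by have [k ->] := vert_surj v; exists (k, false, false, false), 1%N; rewrite /= imset_set1.
- case/finset.setUP => [/finset.setUP[/finset.setUP[]|]|] /imsetP[i _ ->].
  + by have [k kE [k1 k2 _]] := U i; have := edgeE k false; rewrite kE k2.
  + by have [k kE [k1 k2 _]] := V i; have := edgeE k false; rewrite kE k2.
  + by have [k kE [k1 k2 _]] := V i; have := edgeE k true; rewrite kE k1 finset.setUC.
  + by have [k kE [k1 k2 _]] := U i; have := edgeE k true; rewrite kE k1.
- case/finset.setUP => [/finset.setUP[/finset.set2P[->|->]|/imsetP[i _ ->]]|/imsetP[i _ ->]].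
  + exact: (gonE true).
  + exact: (gonE false).
  + have [k kE [k1 k2 _]] := U i; have := triE k; rewrite kE k1 k2.
    by rewrite -!finset.setUA [X in _ :|: X]finset.setUC.
  + have [k kE [k1 k2 _]] := V i; have := triE k; rewrite kE k1 k2.
    by rewrite -!finset.setUA [X in _ :|: X]finset.setUC.
Qed.

Lemma aface_surj F : exists x i, (i <= 4)%N /\ F = aface x i.
Proof.
case: F => A AP; have [x [i [i4 E]]] := antiprism_face_cell AP.
by exists x, i; split=> //; apply: val_inj.
Qed.

Lemma aface_le x i y j : (aface x i <= aface y j)%O = (cell x i \subset cell y j).
Proof.
rewrite -[LHS]/(vert @: cell x i \subset vert @: cell y j).
apply/idP/idP => [|/imsetS//]; move=> sub; apply/fintype.subsetP => k kx.
have := fintype.subsetP sub _ (imset_f vert kx).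
by rewrite (mem_imset _ _ vert_inj).
Qed.

Lemma aface_eq x i y j : aface x i = aface y j <-> cell x i = cell y j.
Proof.
split=> [/(congr1 val)/(imset_inj vert_inj)//|E].
by apply: val_inj; rewrite /= E.
Qed.

Definition arank (F : antiprism n) := crank (vert @^-1: val F).

Lemma arankE x i : (i <= 4)%N -> arank (aface x i) = i.
Proof.
move=> i4; rewrite /arank -[RHS](crank_cell m_gt0 x i4); congr crank.
by apply/setP => k; rewrite inE /= (mem_imset _ _ vert_inj).
Qed.

Lemma aface_lt x i y j : (aface x i < aface y j)%O = (cell x i \proper cell y j).
Proof. by rewrite lt_leAnge !aface_le properE. Qed.

Lemma aface_pair F G : (F <= G)%O ->
  exists x, aface x (arank F) = F /\ aface x (arank G) = G.
Proof.
have [x [i [i4 ->]]] := aface_surj F; have [y [j [j4 ->]]] := aface_surj G.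
rewrite aface_le !arankE// => sub; have [E|/eqP E] := eqVneq (cell x i) (cell y j).
  have ij : i = j by rewrite -(crank_cell m_gt0 x i4) E crank_cell.
  by subst j; exists x; split=> //; apply/aface_eq.
have ij : (i < j)%N.
  by apply: (crank_lt m_gt0 i4 j4 (x := x) (y := y)); rewrite finset.properEneq sub andbT; apply/eqP.
have [|z [zi zj]] := cell_pair m_gt0 _ sub; first by rewrite ij.
by exists z; split; apply/aface_eq.
Qed.

(** The vertices, edges and faces of the antiprism are the images of the cells of
    the zigzag, so the properties of cells carry over. *)
Lemma antiprism_model : flag_model (@adj m) arank aface.
Proof.
split.
- move=> F G; have [x [i [i4 ->]]] := aface_surj F; have [y [j [j4 ->]]] := aface_surj G.
  by rewrite aface_lt !arankE//; exact: crank_lt.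
- by move=> F; have [x [i [i4 ->]]] := aface_surj F; rewrite arankE.
- exact: arankE.
- by move=> x i j ij; rewrite aface_lt cell_mono.
- exact: aface_pair.
- move=> F E G rF rE rG /andP[/ltW FE /ltW/aface_pair[y]]; rewrite rE rG => -[yE yG].
  move: FE rF; rewrite -yE; have [x [i [i4 ->]]] := aface_surj F; rewrite aface_le arankE// => + i1.
  rewrite i1; case: x => -[[j e] s] f; rewrite finset.sub1set => /(vertex_edge_pair m_gt0)[z [z1 z2 z3]].
  by exists z; rewrite -yG; split; apply/aface_eq.
- by move=> i j x ji; apply/aface_eq; rewrite cell_adj// eqSS.
- by move=> i x /aface_eq; exact: cell_adj_neq.
- by move=> i x y xy; apply: cell_diamond => // j /xy /aface_eq.
Qed.

End AntiprismModel.

(** * The octahedron *)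

Section Octahedron.

(** The formulas for the flags of the 3-antiprism, on natural numbers less than
    6, so that they can be evaluated. *)
Definition oflag := (nat * bool * bool * bool)%type.

Definition ostep (j : nat) (e : bool) (c : nat) : nat :=
  if e then (j + 6 - c) %% 6 else (j + c) %% 6.

Definition oadj (i : nat) (x : oflag) : oflag :=
  let: (j, e, s, f) := x in
  match i with
  | 0 => if s then (ostep j e 1, ~~ e, s, ~~ f) else (ostep j e 2, ~~ e, s, f)
  | 1 => if f then (j, e, ~~ s, f) else (j, ~~ e, s, f)
  | _ => (j, e, s, ~~ f)
  end.

Definition owalk (x : oflag) (w : seq nat) : oflag := foldl (fun y i => oadj i y) x w.

(** A word that leads from the base flag to x. Its factors change in turn the
    parity of the vertex (the first word leads to the base flag moved by one
    step), the vertex within its n-gon, the direction and the type. *)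
Definition oword (x : oflag) : seq nat :=
  let: (j, e, s, f) := x in
  (if odd j then [:: 2; 1; 0; 2; 1; 2; 1] else [::]) ++ flatten (nseq j./2 [:: 0; 1])
  ++ nseq e 1 ++ take (if s then (if f then 2 else 3) else nat_of_bool f) [:: 2; 1; 2].

Definition obase : oflag := (0, false, false, false).

Definition oflags : seq oflag :=
  let bools := [:: true; false] in
  [seq (x, f) | x <- [seq (y, s) | y <- [seq (j, e) | j <- iota 0 6, e <- bools], s <- bools],
                f <- bools].

Lemma owalk_word x : x \in oflags -> owalk obase (oword x) = x.
Proof.
have : all (fun x => owalk obase (oword x) == x) oflags by vm_compute.
by move/allP => h /h/eqP.
Qed.

(** The map that sends y to [owalk x (oword y)] is the symmetry of the octahedron
    that takes the base flag to x: that it is compatible with adjacency means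
    that the octahedron is regular. The finitely many cases are evaluated. *)
Lemma owalk_adj x y i : x \in oflags -> y \in oflags -> (i < 3)%N ->
  owalk x (oword (oadj i y)) = oadj i (owalk x (oword y)).
Proof.
have : all (fun x => all (fun y => all (fun i =>
   owalk x (oword (oadj i y)) == oadj i (owalk x (oword y))) (iota 0 3)) oflags) oflags.
  by vm_compute.
move=> /allP h /h/allP{}h /h/allP{}h i3; apply/eqP/h.
by rewrite mem_iota.
Qed.

End Octahedron.

(** * The monodromy group of the antiprism *)

Section Dihedral.
Variable gT : finGroupType.
Local Open Scope group_scope.

(** The involution a inverts the product a * b. *)
Lemma dihedral_mul (a b : gT) : a * a = 1 -> b * b = 1 ->
  <<[set a; b]%SET>> = <[a * b]> * <[a]> :> {set gT}.
Proof.
move=> aa bb; have aV : a^-1 = a by apply/eqP; rewrite eq_invg_mul aa.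
have bV : b^-1 = b by apply/eqP; rewrite eq_invg_mul bb.
have na : <[a]> \subset 'N(<[a * b]>).
  rewrite norms_cycle conjgE aV !mulgA aa mul1g.
  by rewrite -[X in X \in _]invgK invMg aV bV groupV cycle_id.
rewrite -norm_joinEr//; apply/eqP; rewrite finset.eqEsubset; apply/andP; split.
  rewrite gen_subG; apply/fintype.subsetP => x; rewrite !inE => /orP[] /eqP ->.
    by apply: mem_gen; rewrite inE cycle_id orbT.
  have bE : a * (a * b) = b by rewrite mulgA aa mul1g.
  by rewrite -[X in X \in _]bE groupM//; apply: mem_gen; rewrite inE cycle_id ?orbT.
have am : a \in <<[set a; b]%SET>> by rewrite mem_gen// !inE eqxx.
have bm : b \in <<[set a; b]%SET>> by rewrite mem_gen// !inE eqxx orbT.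
by rewrite join_subG !cycle_subG groupM.
Qed.

Lemma dihedral_card (a b : gT) : a * a = 1 -> b * b = 1 -> a \notin <[a * b]> ->
  #|<<[set a; b]%SET>>| = (#[(a * b)%g] * 2)%N.
Proof.
move=> aa bb aN; rewrite dihedral_mul// TI_cardMg; last first.
  rewrite finset.setIC; apply: prime_TIg; last by rewrite cycle_subG.
  by rewrite -orderE (nt_prime_order (p := 2))//; apply: contraNneq aN => ->.
rewrite -!orderE (nt_prime_order (p := 2) (x := a))//.
by apply: contraNneq aN => ->.
Qed.

End Dihedral.

Section Monodromy.
Variable m : nat.
Hypothesis m_gt0 : (0 < m)%N.
Local Notation q := (6 * m)%N.
Local Notation cell := (@cell m).
Local Notation X := (zflag m).

Definition adj_perm (i : 'I_3) : {perm X} := perm (can_inj (adjK (m := m) i)).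

Lemma adj_permE i x : adj_perm i x = adj i x. Proof. exact: permE. Qed.

Lemma antiprism_perm_model : flag_model (fun i => adj_perm i) (arank m_gt0) (aface m_gt0).
Proof.
have -> : (fun i : 'I_3 => adj_perm i : X -> X) = @adj m.
  by apply/funext => i; apply/funext => x; rewrite adj_permE.
exact: antiprism_model.
Qed.

Local Open Scope group_scope.

Lemma adj_perm_inv i : adj_perm i * adj_perm i = 1.
Proof. by apply/permP => x; rewrite permM !adj_permE adjK perm1. Qed.

Lemma adj_perm_comm : commute (adj_perm o0) (adj_perm o2).
Proof.
by apply/permP => -[[[j e] s] f]; rewrite !permM !adj_permE /adj /=; case: s; case: f.
Qed.

(** The orientation of the antiprism: the translation by one step of
    the zigzag is an orientation-reversing symmetry, whence the parity of the vertex. *)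
Definition orient (x : X) : bool := let: (j, e, s, f) := x in parity j (+) e (+) s (+) f.

Lemma orient_adj_perm i x : orient (adj_perm i x) = ~~ orient x.
Proof.
case: x => -[[j e] s] f; rewrite adj_permE; move: i; apply: ord3_case; rewrite /adj /orient /=.
- by case: s; rewrite parity_step//=; case: (parity j); case: e; case: f.
- by case: f; case: (parity j); case: e; case: s.
- by case: f; case: (parity j); case: e; case: s.
Qed.

(** Products of two generators preserve the orientation. *)
Lemma adj_perm_notin_rotations i j : adj_perm i \notin <[adj_perm i * adj_perm j]>.
Proof.
apply/cycleP => -[k rk]; have ok x : orient (((adj_perm i * adj_perm j) ^+ k) x) = orient x.
  elim: k {rk} => [|k IH]; first by rewrite expg0 perm1.
  by rewrite expgSr !permM !orient_adj_perm negbK.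
have := ok (0%R, false, false, false); rewrite -rk orient_adj_perm.
by case: orient.
Qed.

Lemma parabolic_pair (a b : 'I_3) k :
  (forall j : 'I_3, (j.+1 != k) = (j == a) || (j == b)) ->
  parabolic adj_perm k = <<[set adj_perm a; adj_perm b]%SET>> :> {set {perm X}}.
Proof.
move=> kab; congr <<_>>; apply/setP => x; rewrite !inE; apply/imsetP/orP => [[j + ->]|].
  by rewrite inE kab => /orP[] /eqP ->; [left|right].
by case=> /eqP ->; [exists a|exists b]; rewrite ?inE ?kab ?eqxx ?orbT.
Qed.

Lemma parabolic1 : parabolic adj_perm 1 = <<[set adj_perm o1; adj_perm o2]%SET>> :> {set {perm X}}.
Proof. by apply: parabolic_pair; apply: ord3_case. Qed.

Lemma parabolic2 : parabolic adj_perm 2 = <<[set adj_perm o0; adj_perm o2]%SET>> :> {set {perm X}}.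
Proof. by apply: parabolic_pair; apply: ord3_case. Qed.

Lemma parabolic3 : parabolic adj_perm 3 = <<[set adj_perm o0; adj_perm o1]%SET>> :> {set {perm X}}.
Proof. by apply: parabolic_pair; apply: ord3_case. Qed.

Lemma vertex_rotation4 : (adj_perm o1 * adj_perm o2) ^+ 4 = 1.
Proof.
apply/permP => -[[[j e] s] f]; rewrite !expgS expg0 !permM !perm1 !adj_permE /adj /=.
by case: s; case: f; rewrite /= ?negbK.
Qed.

(** Whether the face of x is one of the two n-gons. *)
Definition on_ngon (x : X) : bool := let: (j, e, s, f) := x in ~~ s && ~~ f.

Lemma parabolic3_ngon w x : w \in parabolic adj_perm 3 -> on_ngon (w x) = on_ngon x.
Proof.
rewrite parabolic3; move: w; apply: gen_ind => [|w a IH]; first by rewrite perm1.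
rewrite permM -{}IH; case: (w x) => -[[j e] s] f.
by rewrite !inE => /orP[] /eqP ->; rewrite adj_permE /adj /=; case: s; case: f.
Qed.

(** The nontrivial powers of the rotation r_1 r_2 take a flag at an n-gon
    to flags at the three triangles around its vertex, whereas r_0 and r_1 keep
    the face. *)
Lemma rotation_parabolic3 k : (adj_perm o1 * adj_perm o2) ^+ k \in parabolic adj_perm 3 ->
  (adj_perm o1 * adj_perm o2) ^+ k = 1.
Proof.
rewrite -(expg_mod k vertex_rotation4).
have := ltn_pmod k (isT : 0 < 4)%N; move: (k %% 4)%N => {}k k4.
move=> /(parabolic3_ngon (0%R, false, false, false)).
case: k k4 => [|[|[|[|//]]]] _; first by rewrite expg0.
all: by rewrite !expgS expg0 !permM !perm1 !adj_permE /adj /=.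
Qed.

Lemma adj_perm_cap w : w \in parabolic adj_perm 1 -> w \in parabolic adj_perm 3 -> w = 1 \/ w = adj_perm o1.
Proof.
rewrite parabolic1 dihedral_mul ?adj_perm_inv// => /mulsgP[_ v /cycleP[k ->] /cycleP[l ->] ->].
have r13 : adj_perm o1 \in parabolic adj_perm 3 by rewrite parabolic3 mem_gen// !inE eqxx orbT.
rewrite (groupMr _ (groupX l r13)) => /rotation_parabolic3 ->; rewrite mul1g.
rewrite -(expg_mod (p := 2) l); last exact: adj_perm_inv.
by have := ltn_pmod l (isT : 0 < 2)%N; case: (l %% 2)%N => [|[|//]] _; [left|right].
Qed.

Lemma parabolic_cell w k x : w \in parabolic adj_perm k -> cell (w x) k = cell x k.
Proof.
move: w; apply: gen_ind => [|w a IH /imsetP[j + ->]]; first by rewrite perm1.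
by rewrite inE => jk; rewrite permM adj_permE cell_adj// eq_sym.
Qed.

Lemma adj_perm_notin i : adj_perm i \notin parabolic adj_perm i.+1.
Proof.
apply/negP => /(@parabolic_cell _ _ (0%R, false, false, false)).
by rewrite adj_permE; exact: cell_adj_neq.
Qed.

Lemma card_parabolic1 : #|parabolic adj_perm 1| = 8.
Proof.
rewrite parabolic1 dihedral_card ?adj_perm_inv ?adj_perm_notin_rotations//.
suff -> : #[adj_perm o1 * adj_perm o2] = 4 by [].
have := order_dvdn (adj_perm o1 * adj_perm o2) 4; rewrite vertex_rotation4 eqxx => d4.
have d2 : ~~ (#[adj_perm o1 * adj_perm o2] %| 2)%N.
  rewrite order_dvdn; apply/eqP => /permP /(_ (0%R, false, false, false)).
  by rewrite !expgS expg0 !permM !perm1 !adj_permE.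
have le4 := dvdn_leq (isT : 0 < 4)%N d4; move: le4 d4 d2.
by case: #[_] => [|[|[|[|[|]]]]].
Qed.

Lemma card_parabolic2 : #|parabolic adj_perm 2| = 4.
Proof.
rewrite parabolic2 dihedral_card ?adj_perm_inv ?adj_perm_notin_rotations//.
rewrite (nt_prime_order (p := 2))//.
  by rewrite (expgS _ 1) expg1 mulgA -(mulgA (adj_perm o0)) -adj_perm_comm mulgA adj_perm_inv mul1g adj_perm_inv.
apply/eqP => /permP /(_ (0%R, false, false, false)).
by rewrite permM perm1 !adj_permE.
Qed.

End Monodromy.

Section MonodromyOrder.
Variable m : nat.
Hypothesis m_gt0 : (0 < m)%N.
Local Notation q := (6 * m)%N.
Local Notation X := (zflag m).
Local Notation adj_perm := (@adj_perm m).
Local Open Scope group_scope.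

(** The flags of type t = (s, f) are moved by c steps, in their own direction. *)
Definition shift (t : bool * bool) (c : nat) (x : X) : X :=
  let: (j, e, s, f) := x in if (s, f) == t then (step j e c, e, s, f) else x.

Lemma shift_inj t c : injective (shift t c).
Proof.
apply: (can_inj (g := fun x : X => let: (j, e, s, f) := x in
  if (s, f) == t then (step j (~~ e) c, e, s, f) else x)) => -[[[j e] s] f].
by rewrite /shift; case: ifP => /= [->|->//]; rewrite stepB// subnn step0.
Qed.

Definition translation t : {perm X} := perm (@shift_inj t 6).

Lemma translation_expg t k x : (translation t ^+ k) x = shift t (6 * k) x.
Proof.
elim: k => [|k IH].
  rewrite expg0 perm1 muln0; case: x => -[[j e] s] f.
  by rewrite /shift step0; case: ifP.
rewrite expgSr permM IH permE; case: x {IH} => -[[j e] s] f.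
rewrite /shift; case: ifP => /= ->//.
by rewrite stepD mulnSr.
Qed.

(** The product r_0 r_1 rotates each face by one of its edges, which for an n-gon
    is two steps of the zigzag; its cube fixes the flags at the triangles. *)
Lemma translation_ngon : translation (false, false) = (adj_perm o0 * adj_perm o1) ^+ 3.
Proof.
apply/permP => -[[[j e] s] f]; rewrite permE !expgS expg0 !permM perm1 !adj_permE /shift /adj.
have back c : step (step j (~~ e) c) e c = j by rewrite -{2}[e]negbK stepB// subnn step0.
case: s; case: f; rewrite //= ?negbK ?stepD// ?(stepB_rev _ _ (isT : 1 <= 2)%N) ?stepB// ?step0// ?back//.
Qed.

(** The involutions r_1 and r_2 permute the four types; on the two types that are
    exchanged here, they keep the vertex and the direction. *)
Lemma translation_conj :
  [/\ translation (false, true) = adj_perm o2 * translation (false, false) * adj_perm o2,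
      translation (true, true) = adj_perm o1 * translation (false, true) * adj_perm o1 &
      translation (true, false) = adj_perm o2 * translation (true, true) * adj_perm o2].
Proof.
by split; apply/permP => -[[[j e] s] f]; rewrite !permM !permE /shift /adj /=;
  case: s; case: f; rewrite //= ?negbK.
Qed.

Lemma translation_in t : translation t \in flag_group (r := adj_perm).
Proof.
have rG i : adj_perm i \in flag_group (r := adj_perm) by rewrite mem_gen// imset_f.
have [E1 E2 E3] := translation_conj.
have T0 : translation (false, false) \in flag_group (r := adj_perm).
  by rewrite translation_ngon groupX// groupM ?rG.
have T1 : translation (false, true) \in flag_group (r := adj_perm) by rewrite E1 !groupM ?rG.
have T2 : translation (true, true) \in flag_group (r := adj_perm) by rewrite E2 !groupM ?rG.
by case: t => -[] [] //; rewrite E3 !groupM ?rG.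
Qed.

Lemma step_period (j : 'Z_q) e k : (step j e k == j) = (q %| k)%N.
Proof.
have -> : (step j e k == j) = ((k%:R : 'Z_q) == 0)%R.
  by rewrite /step; case: e; rewrite -subr_eq0 addrC addrA ?addNr ?add0r ?oppr_eq0.
by rewrite -val_eqE /= val_Zp_nat ?q_gt1.
Qed.

Lemma ngon_rotation k j e : ((adj_perm o0 * adj_perm o1) ^+ k) (j, e, false, false) = (step j e (2 * k), e, false, false).
Proof.
elim: k => [|k IH]; first by rewrite expg0 perm1 muln0 step0.
by rewrite expgSr permM IH permM !adj_permE /adj /= negbK stepD mulnSr.
Qed.

Lemma order_ngon_rotation : #[adj_perm o0 * adj_perm o1] = (3 * m)%N.
Proof.
apply/eqP; rewrite eqn_dvd order_dvdn; apply/andP; split.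
  rewrite expgM -translation_ngon; apply/eqP/permP => -[[[j e] s] f].
  rewrite translation_expg perm1 /shift; case: ifP => // _.
  by have /eqP -> : step j e (6 * m) == j by rewrite step_period.
have := expg_order (adj_perm o0 * adj_perm o1) => /permP/(_ (0%R, false, false, false)).
rewrite ngon_rotation perm1; set k := #[_] => /(congr1 (fun z : X => z.1.1.1)) E.
have {}E : step 0%R false (2 * k) = 0%R :> 'Z_q := E.
have := step_period 0%R false (2 * k); rewrite E eqxx => /esym.
by rewrite (_ : 6 * m = 2 * (3 * m))%N ?dvdn_pmul2l// mulnA.
Qed.

Lemma card_parabolic3 : #|parabolic adj_perm 3| = (6 * m)%N.
Proof.
rewrite parabolic3 dihedral_card ?adj_perm_inv ?adj_perm_notin_rotations//.
by rewrite order_ngon_rotation -mulnA mulnC -mulnA mulnC; lia.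
Qed.

Let x0 : X := (0%R, false, false, false).

Definition red (x : X) : oflag := let: (j, e, s, f) := x in ((j %% 6)%N, e, s, f).

Lemma step_mod6 (j : 'Z_q) e c : (c <= 6)%N -> (step j e c %% 6 = ostep (j %% 6) e c)%N.
Proof.
move=> c6; have addE (a b : 'Z_q) : ((a + b)%R %% 6 = (a + b) %% 6)%N.
  by rewrite /= modn_dvdm// Zp_trunc_q// dvdn_mulr.
have natE : ((c%:R : 'Z_q)%R %% 6 = c %% 6)%N.
  by rewrite val_Zp_nat ?q_gt1// modn_dvdm// dvdn_mulr.
rewrite /step /ostep; case: e; last by rewrite addE -modnDm natE modnDm modnDml.
have := addE (j - c%:R)%R c%:R%R; rewrite subrK -modnDmr natE.
by lia.
Qed.

Lemma red_adj (i : 'I_3) x : red (adj i x) = oadj i (red x).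
Proof.
case: x => -[[j e] s] f; move: i; apply: ord3_case; rewrite /adj /red /=.
- by case: s; rewrite step_mod6.
- by case: f.
- by [].
Qed.

Lemma red_in x : red x \in oflags.
Proof.
case: x => -[[j e] s] f; rewrite /red; have := ltn_pmod j (isT : 0 < 6)%N.
by move: (j %% 6)%N => [|[|[|[|[|[|//]]]]]] _; case: e; case: s; case: f.
Qed.

(** Modulo 6, an element of the group is determined by the image of a single flag,
    by the regularity of the octahedron. *)
Lemma red_action g x : g \in flag_group (r := adj_perm) ->
  red (g x) = owalk (red x) (oword (red (g x0))).
Proof.
move: g; apply: gen_ind => [|g _ IH /imsetP[i _ ->]]; first by rewrite !perm1.
by rewrite !permM !adj_permE !red_adj owalk_adj ?red_in// IH.
Qed.

Local Notation G := (flag_group (r := adj_perm)).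

Lemma red_mul g h : g \in G -> h \in G ->
  red ((g * h) x0) = owalk (red (g x0)) (oword (red (h x0))).
Proof. by move=> gG hG; rewrite permM red_action. Qed.

Lemma red_transitive z : z \in oflags -> exists2 g, g \in G & red (g x0) = z.
Proof.
move=> zO.
suff : exists2 g, g \in G & red (g x0) = owalk obase (oword z) by rewrite owalk_word.
have : all (fun i => i < 3)%N (oword z).
  have : all (fun z => all (fun i => i < 3)%N (oword z)) oflags by vm_compute.
  by move/allP => /(_ z zO).
elim/last_ind: (oword z) => [|w i IH]; first by exists 1; rewrite ?group1// perm1.
rewrite all_rcons => /andP[i3 /IH[g gG rg]].
exists (g * adj_perm (Ordinal i3)); first by rewrite groupM// mem_gen// imset_f.
by rewrite permM adj_permE red_adj rg /owalk foldl_rcons.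
Qed.

(** With [flip_flag], the symmetries of the antiprism: the dihedral group acting on
    the zigzag. *)
Definition rotate_flag (a : 'Z_q) (x : X) : X := let: (j, e, s, f) := x in ((a + j)%R, e, s, f).
Definition flip_flag (x : X) : X := let: (j, e, s, f) := x in ((- j)%R, ~~ e, s, f).

Lemma rotate_flag_comm a g x : g \in G -> g (rotate_flag a x) = rotate_flag a (g x).
Proof.
move: g; apply: gen_ind => [|g _ IH /imsetP[i _ ->]]; first by rewrite !perm1.
rewrite !permM IH !adj_permE; case: (g x) => -[[j e] s] f.
move: i; apply: ord3_case; rewrite /adj /rotate_flag /=; case: s; case: f => //=;
  by rewrite /step; case: e; rewrite ?addrA.
Qed.

Lemma flip_flag_comm g x : g \in G -> g (flip_flag x) = flip_flag (g x).
Proof.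
move: g; apply: gen_ind => [|g _ IH /imsetP[i _ ->]]; first by rewrite !perm1.
rewrite !permM IH !adj_permE; case: (g x) => -[[j e] s] f.
move: i; apply: ord3_case; rewrite /adj /flip_flag /=; case: s; case: f => //=;
  by rewrite /step; case: e; rewrite /= ?opprD ?opprK.
Qed.

Definition kernel : {set {perm X}} := [set g in G | red (g x0) == obase]%SET.

Lemma kernel_red g x : g \in kernel -> red (g x) = red x.
Proof.
by rewrite inE => /andP[gG /eqP rg]; rewrite red_action// rg.
Qed.

Definition multi_translation (y : {ffun bool * bool -> 'I_m}) : {perm X} :=
  \prod_t translation t ^+ y t.

Lemma multi_translationE y j e s f :
  multi_translation y (j, e, s, f) = (step j e (6 * y (s, f)), e, s, f).
Proof.
have prodE (r : seq (bool * bool)) i : uniq r ->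
    (\prod_(t <- r) translation t ^+ y t) (i, e, s, f) =
    if (s, f) \in r then (step i e (6 * y (s, f)), e, s, f) else (i, e, s, f).
  elim: r i => [|t r IH] i /=; first by rewrite big_nil perm1.
  move=> /andP[tr ru]; rewrite big_cons permM translation_expg inE /shift.
  have [tE|_] := eqVneq (s, f) t; last exact: IH.
  by rewrite IH// tE (negPf tr).
by rewrite /multi_translation prodE ?index_enum_uniq// mem_index_enum.
Qed.

Lemma div6_lt (k : 'Z_q) : (k %/ 6 < m)%N.
Proof.
have kq : (k < 6 * m)%N by have := ltn_ord k; rewrite {2}Zp_trunc_q.
by rewrite ltn_divLR// (mulnC m).
Qed.

(** An element g of the kernel fixes the directions and the types, and moves the
    vertices by multiples of 6. The dihedral group is transitive on the flags of
    each type and commutes with g, so the displacement of one flag of each type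
    determines g. *)
Lemma kernelE : kernel = [set multi_translation y | y : {ffun bool * bool -> 'I_m}]%SET.
Proof.
apply/setP => g; apply/idP/imsetP => [gN|[y _ ->]]; last first.
  rewrite inE group_prod => [|t _]; last by rewrite groupX// translation_in.
  have : red (multi_translation y x0) = obase; last by move=> ->.
  rewrite multi_translationE /red; congr (_, _, _, _).
  by rewrite /step add0r val_Zp_nat ?q_gt1// modn_dvdm ?dvdn_mulr// modnMr.
have gG : g \in G by move: gN; rewrite inE => /andP[].
exists [ffun t => Ordinal (div6_lt (g (0%R, false, t.1, t.2)).1.1.1)] => //.
have g0 s f : g (0%R, false, s, f) =
    (step 0%R false (6 * ((g (0%R, false, s, f)).1.1.1 %/ 6)), false, s, f).
  have := kernel_red (0%R, false, s, f) gN; case: (g _) => -[[k e] s'] f' [k6 -> -> ->] /=.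
  congr (_, _, _, _); apply: ord_inj; rewrite /step add0r val_Zp_nat ?q_gt1//.
  rewrite (mulnC 6 (_ %/ 6)%N) divnK; last by rewrite /dvdn k6 mod0n.
  by rewrite modn_small//; have := ltn_ord k; rewrite {2}Zp_trunc_q.
apply/permP => -[[[j e] s] f]; rewrite multi_translationE ffunE /=.
have -> : (j, e, s, f) = rotate_flag j (if e then flip_flag (0%R, false, s, f) else (0%R, false, s, f)) :> X.
  by case: e; rewrite /rotate_flag /= ?oppr0 addr0.
rewrite rotate_flag_comm//; case: e; rewrite ?flip_flag_comm// [in LHS]g0 /rotate_flag /flip_flag /=.
  by rewrite /step add0r.
by rewrite /step add0r.
Qed.

Lemma multi_translation_inj : injective multi_translation.
Proof.
move=> y y' yy; apply/ffunP => -[s f]; apply: val_inj.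
have := congr1 (fun g : {perm X} => (g (0%R, false, s, f)).1.1.1) yy.
rewrite !multi_translationE /= /step !add0r => /(congr1 val) /=.
by rewrite !val_Zp_nat ?q_gt1// !modn_small ?ltn_pmul2l// => /eqP; rewrite eqn_pmul2l// => /eqP.
Qed.

Lemma card_kernel : #|kernel| = (m ^ 4)%N.
Proof.
rewrite kernelE card_imset; last exact: multi_translation_inj.
by rewrite card_ffun card_prod card_bool card_ord.
Qed.

(** The fibres are the cosets of the kernel. *)
Lemma card_fiber z : z \in oflags -> #|[set g in G | red (g x0) == z]%SET| = #|kernel|.
Proof.
move=> /red_transitive[w wG wz]; rewrite -(card_rcoset kernel w).
apply: eq_card => g; rewrite mem_rcoset !inE.
rewrite (groupMr _ (groupVr wG)); apply: andb_id2l => gG.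
have wVG : w^-1 \in G by rewrite groupV.
apply/eqP/eqP => [gz|].
  by rewrite red_mul// gz -wz -red_mul// mulgV perm1.
move=> gw; have -> : g = (g * w^-1) * w by rewrite mulgKV.
by rewrite red_mul ?groupM// gw wz owalk_word// -wz red_in.
Qed.

Lemma card_flag_group : #|G| = (48 * m ^ 4)%N.
Proof.
have one (g : {perm X}) : (1 = \sum_(z <- oflags) (red (g x0) == z))%N.
  rewrite (bigD1_seq (red (g x0))) ?red_in//= eqxx big1// => z.
  by rewrite eq_sym => /negPf ->.
rewrite -sum1_card (eq_bigr _ (fun g _ => one g)) exchange_big /=.
rewrite (eq_big_seq (fun=> #|kernel|)) => [|z zO].
  by rewrite big_const_seq count_predT iter_addn_0 card_kernel mulnC.
rewrite -(card_fiber zO) -sum1dep_card big_mkcondr /=.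
by apply: eq_bigr => g _; case: eqP.
Qed.

End MonodromyOrder.

(** * The minimal regular cover *)

Section Final.
Variable m : nat.
Hypothesis m_gt0 : (0 < m)%N.
Local Notation X := (zflag m).
Local Notation adj_perm := (@adj_perm m).
Local Notation G := (flag_group (r := adj_perm)).
Local Open Scope group_scope.

Lemma adj_perm_in i : adj_perm i \in G.
Proof. by rewrite mem_gen// imset_f. Qed.

(** The monodromy group as a group in its own right, whose elements are to be the
    flags of the cover. *)
Definition mon_gen (i : 'I_3) : subg_of G := subg G (adj_perm i).

Lemma sgval_mon_gen i : sgval (mon_gen i) = adj_perm i.
Proof. by rewrite subgK// adj_perm_in. Qed.

Lemma sgval_gen (D : {pred 'I_3}) w :
  (w \in <<[set mon_gen j | j in D]%SET>>) = (sgval w \in <<[set adj_perm j | j in D]%SET>>).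
Proof.
apply/idP/idP.
  move: w; apply: gen_ind => [|w a IH /imsetP[j jD ->]]; first exact: group1.
  by rewrite /= sgval_mon_gen; apply: groupM => //; apply/mem_gen/imset_f.
rewrite -{2}(sgvalK w); move: (sgval w) => v vD.
suff [] : v \in G /\ subg G v \in <<[set mon_gen j | j in D]%SET>> by [].
move: v vD; apply: gen_ind => [|v a [vG IH] /imsetP[j jD ->]].
  by rewrite morph1 !group1.
split; first by rewrite groupM// adj_perm_in.
by rewrite subgM ?adj_perm_in//; apply: groupM => //; apply/mem_gen/imset_f.
Qed.

Lemma mon_gen_parabolic k w : (w \in parabolic mon_gen k) = (sgval w \in parabolic adj_perm k).
Proof. exact: sgval_gen. Qed.

Lemma sgval_inj : injective (@sgval _ G). Proof. exact: val_inj. Qed.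

Lemma card_mon_parabolic k : #|parabolic mon_gen k| = #|parabolic adj_perm k|.
Proof.
rewrite -(card_imset _ sgval_inj); apply: eq_card => x; apply/imsetP/idP.
  by move=> [w + ->]; rewrite mon_gen_parabolic.
move=> xH; have xG : x \in G.
  move: xH; apply: (fintype.subsetP _); apply: genS; apply/fintype.subsetP => _ /imsetP[j _ ->].
  exact: imset_f.
by exists (subg G x); rewrite ?mon_gen_parabolic subgK.
Qed.

Lemma card_mon : #|[set: subg_of G]%SET| = (48 * m ^ 4)%N.
Proof.
rewrite -card_flag_group// -(card_imset _ sgval_inj); apply: eq_card => x.
apply/imsetP/idP => [[w _ ->]|xG]; first exact: subgP.
by exists (subg G x); rewrite ?inE ?subgK.
Qed.

Definition monodromy_string : string_C_group (subg_of G).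
Proof.
exists mon_gen.
- by apply/setP => w; rewrite sgval_gen inE; exact: subgP.
- by move=> i; apply: sgval_inj; rewrite /= sgval_mon_gen adj_perm_inv.
- by apply: sgval_inj; rewrite /= !sgval_mon_gen; exact: adj_perm_comm.
- by move=> i; rewrite mon_gen_parabolic sgval_mon_gen adj_perm_notin.
- move=> w; rewrite !mon_gen_parabolic => w1 w3.
  by have [E|E] := adj_perm_cap w1 w3; [left|right]; apply: sgval_inj; rewrite E ?sgval_mon_gen.
Defined.

Local Notation S := monodromy_string.

Lemma index_parabolic k :
  (#|parabolic adj_perm k| * #|[set: subg_of G]%SET : parabolic S k| = 48 * m ^ 4)%N.
Proof.
by rewrite -card_mon -(Lagrange (finset.subsetT (parabolic S k))) card_mon_parabolic.
Qed.

Lemma index_parabolic1 : #|[set: subg_of G]%SET : parabolic S 1| = (6 * m ^ 4)%N.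
Proof. by have := index_parabolic 1; rewrite card_parabolic1//; lia. Qed.

Lemma index_parabolic2 : #|[set: subg_of G]%SET : parabolic S 2| = (12 * m ^ 4)%N.
Proof. by have := index_parabolic 2; rewrite card_parabolic2//; lia. Qed.

Lemma index_parabolic3 : #|[set: subg_of G]%SET : parabolic S 3| = (8 * m ^ 3)%N.
Proof.
have := index_parabolic 3; rewrite card_parabolic3// => E; apply/eqP.
rewrite -(eqn_pmul2l (m := 6 * m)) ?muln_gt0//; apply/eqP; rewrite E (expnS m 3).
by lia.
Qed.

(** The coset poset of the monodromy group lies between A and the antiprism. *)
Lemma minimal_cover_isomorphic d (A : tbPOrderType d) :
  minimal_regular_cover A (antiprism (3 * m)) -> isomorphic (coset_face S) A.
Proof.
move=> [_ _ covA minA]; apply: minA.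
- exact: coset_polyhedron.
- exact: coset_regular.
- apply: (coset_covers (antiprism_perm_model m_gt0) (phi := @sgval _ G)) => //.
  + by move=> x; exact: subgP.
  + exact: sgval_mon_gen.
- apply: (cover_factor (antiprism_perm_model m_gt0) (psi := subg G)) covA => //.
  exact: subgM.
Qed.

Lemma orient_rmul i (g : subg_of G) : let o (g : subg_of G) := orient (sgval g (0%R, false, false, false)) in
  o (rmul S i g) = ~~ o g.
Proof. by rewrite /= rmulE /= sgval_mon_gen permM orient_adj_perm. Qed.

End Final.

Theorem mainTheorem4 (R : realType) (m : nat) (hm : (1 <= m)%N)
    (d : Order.disp_t) (A : tbPOrderType d)
    (hA : minimal_regular_cover A (antiprism (3 * m))) :
  [/\ [/\ (of_rank 0 : set A) #= `I_(6 * m ^ 4),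
          (of_rank 1 : set A) #= `I_(12 * m ^ 4)
        & (of_rank 2 : set A) #= `I_(8 * m ^ 3)],
      compact [set: surface R A] /\ orientable A,
      euler_characteristic A
        = (8 * m%:Z ^+ 3 - 12 * m%:Z ^+ 4 + 6 * m%:Z ^+ 4)%R
    & exists2 g : nat,
        (g%:Z = 3 * m%:Z ^+ 4 - 4 * m%:Z ^+ 3 + 1)%R & has_genus R A g].
Proof.
have iso := minimal_cover_isomorphic hm hA.
have c0 := isomorphic_card iso (isT : 0 < 3)%N; rewrite index_parabolic1// in c0.
have c1 := isomorphic_card iso (isT : 1 < 3)%N; rewrite index_parabolic2// in c1.
have c2 := isomorphic_card iso (isT : 2 < 3)%N; rewrite index_parabolic3// in c2.
have [rkA [faceA fmA]] := isomorphic_model iso.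
have cpt : compact [set: surface R A] by exact: (surface_compact fmA).
have con : connected [set: surface R A] by apply: (surface_connected fmA); exact: rmulg_transitive.
have ori : orientable A by apply: (orientable_model fmA); exact: orient_rmul.
have natE (a k : nat) : ((a * m ^ k)%N%:Z = a%:Z * m%:Z ^+ k)%R.
  by rewrite -!natz natrM natrX !natz.
have euler : euler_characteristic A = (8 * m%:Z ^+ 3 - 12 * m%:Z ^+ 4 + 6 * m%:Z ^+ 4)%R.
  by rewrite /euler_characteristic !(card_fset_set c0, card_fset_set c1, card_fset_set c2) !natE; ring.
split=> //.
have m43 : (4 * m ^ 3 <= 3 * m ^ 4 + 1)%N.
  have [->//|m2] : m = 1%N \/ (2 <= m)%N by lia.
  apply: leq_trans (leq_addr _ _); rewrite (expnS m 3) mulnA leq_mul2r.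
  by apply/orP; right; lia.
have gE : ((3 * m ^ 4 + 1 - 4 * m ^ 3)%N%:Z = 3 * m%:Z ^+ 4 - 4 * m%:Z ^+ 3 + 1)%R.
  by rewrite -subzn// PoszD !natE; ring.
exists (3 * m ^ 4 + 1 - 4 * m ^ 3)%N; first exact: gE.
by split=> //; rewrite gE euler; ring.
Qed.
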